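(* For any integers $k,m\geq 2$, the group $\mathbb F_k\times\mathbb F_m$ is not flexibly HS-stable.
   Context: $\mathbb F_k$ denotes the free group on $k$ generators. For $A\in\mathbb M_d(\mathbb C)$, $\|A\|_2=(\frac1d\sum_{i,j}|a_{i,j}|^2)^{1/2}$ is the normalized Hilbert–Schmidt norm, and $\mathrm U(d)$ is the group of $d\times d$ unitary matrices. For a countable group $\Gamma$, a sequence of maps $\varphi_n:\Gamma\to\mathrm U(d_n)$ ($d_n\in\mathbb N$) is an asymptotic homomorphism if $\lim_{n\to\infty}\|\varphi_n(gh)-\varphi_n(g)\varphi_n(h)\|_2=0$ for all $g,h\in\Gamma$. $\Gamma$ is flexibly HS-stable if for every asymptotic homomorphism $\varphi_n:\Gamma\to\mathrm U(d_n)$ there exist homomorphisms $\rho_n:\Gamma\to\mathrm U(D_n)$, with $D_n\geq d_n$ and $\lim_{n\to\infty}D_n/d_n=1$, such that $\lim_{n\to\infty}\|\varphi_n(g)-p_n\rho_n(g)p_n\|_2=0$ for every $g\in\Gamma$, where $p_n:\mathbb C^{D_n}\to\mathbb C^{d_n}$ is the orthogonal projection (and $p_n\rho_n(g)p_n$ is viewed as a $d_n\times d_n$ matrix). *)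

(* Defs.v *)
From HB Require Import structures.
From mathcomp Require Import all_boot all_order all_algebra.
From mathcomp Require Import reals.
From mathcomp Require Import complex.
Set Implicit Arguments. Unset Strict Implicit. Unset Printing Implicit Defensive.
Import Order.TTheory GRing.Theory Num.Theory.
Local Open Scope ring_scope.

(* a letter is a generator index together with a sign (true = inverse) *)
Definition letter (k : nat) := ('I_k * bool)%type.

Definition linv k (x : letter k) : letter k := (x.1, ~~ x.2).

Fixpoint reduced k (s : seq (letter k)) : bool :=
  match s with
  | x :: ((y :: _) as s') => (y != linv x) && reduced s'
  | _ => true
  end.

Definition red_cons k (x : letter k) (w : seq (letter k)) : seq (letter k) :=
  match w with
  | y :: w' => if y == linv x then w' else x :: w
  | [::] => [:: x]
  end.

Definition reduce k (w : seq (letter k)) : seq (letter k) :=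
  foldr (@red_cons k) [::] w.

Lemma reduced_behead k (w : seq (letter k)) : reduced w -> reduced (behead w).
Proof. by case: w => [|x [|y w]] //= /andP[]. Qed.

Lemma reduced_red_cons k (x : letter k) w :
  reduced w -> reduced (red_cons x w).
Proof.
case: w => [|y w] // Hw; rewrite /red_cons.
case: ifP => [_|/negbT Hy]; first exact: (reduced_behead Hw).
by apply/andP; split.
Qed.

Lemma reduced_reduce k (w : seq (letter k)) : reduced (reduce w).
Proof. by elim: w => [|x w IH] //=; apply: reduced_red_cons. Qed.

Definition FreeGroup (k : nat) := {w : seq (letter k) | reduced w}.

Definition fg_mul k (g h : FreeGroup k) : FreeGroup k :=
  exist _ (reduce (sval g ++ sval h)) (reduced_reduce _).

Definition FkFm (k m : nat) := (FreeGroup k * FreeGroup m)%type.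

Definition prod_mul k m (g h : FkFm k m) : FkFm k m :=
  (fg_mul g.1 h.1, fg_mul g.2 h.2).

Definition adjmx (R : realType) (d : nat) (A : 'M[R[i]]_d) : 'M[R[i]]_d :=
  map_mx Num.conj A^T.

Definition unitary (R : realType) (d : nat) (A : 'M[R[i]]_d) : Prop :=
  A *m adjmx A = 1%:M.

Definition hs_norm (R : realType) (d : nat) (A : 'M[R[i]]_d) : R :=
  Num.sqrt ((d%:R)^-1 *
    \sum_(i < d) \sum_(j < d) ((complex.Re (A i j)) ^+ 2 + (complex.Im (A i j)) ^+ 2)).

Definition seq_cvg (R : realType) (u : nat -> R) (l : R) : Prop :=
  forall eps : R, 0 < eps -> exists N : nat, forall n, (N <= n)%N ->
    `|u n - l| < eps.

Definition asymptotic_hom (R : realType) (G : Type) (mul : G -> G -> G)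
    (d : nat -> nat) (phi : forall n : nat, G -> 'M[R[i]]_(d n)) : Prop :=
  (forall n g, unitary (phi n g)) /\
  (forall g h : G,
     seq_cvg (fun n => hs_norm (phi n (mul g h) - phi n g *m phi n h)) 0).

Definition is_unitary_rep (R : realType) (G : Type) (mul : G -> G -> G)
    (D : nat) (rho : G -> 'M[R[i]]_D) : Prop :=
  (forall g, unitary (rho g)) /\ (forall g h, rho (mul g h) = rho g *m rho h).

(* Flexible HS-stability.  A dimension D_n >= d_n is written d_n + e_n, and
   p_n rho_n(g) p_n (compression to the first d_n coordinates) is the
   upper-left d_n x d_n block of rho_n(g). *)
Definition flexibly_HS_stable (R : realType) (G : Type) (mul : G -> G -> G)
    : Prop :=
  forall (d : nat -> nat) (phi : forall n : nat, G -> 'M[R[i]]_(d n)),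
    (forall n, (0 < d n)%N) ->
    asymptotic_hom mul phi ->
    exists (e : nat -> nat)
           (rho : forall n : nat, G -> 'M[R[i]]_(d n + e n)),
      (forall n, is_unitary_rep mul (rho n)) /\
      seq_cvg (fun n => ((d n + e n)%:R / (d n)%:R : R)) 1 /\
      (forall g : G,
         seq_cvg (fun n => hs_norm (phi n g - ulsubmx (rho n g))) 0).

(* Main.v *)
From HB Require Import structures.
Require Import Defs.
From mathcomp Require Import all_boot all_order all_algebra all_fingroup.
From mathcomp Require Import reals complex trigo.
From mathcomp Require Import ring lra zify.
Set Implicit Arguments. Unset Strict Implicit. Unset Printing Implicit Defensive.
Import Order.TTheory GRing.Theory Num.Theory.

(** Let three involutions move a walker on a finite cubic graph of large girth;
    the walker toggles every edge it crosses, and X is the set of its states.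
    Two states whose edge sets differ in few places are joined by a unique short
    path, so near the diagonal of X * X the action on the first coordinate looks
    like the action of Z/2 * Z/2 * Z/2 on a tree: the sets W_i of pairs whose
    path ends with colour i are disjoint, and x_i x_j moves everything near the
    diagonal and outside W_j into W_i.  On C^m (x) l^2(X) let F_m act through
    1 (x) x_0x_1 and 1 (x) x_0x_2, and let F_k act through the discrete Fourier
    transform of C^m and the diagonal operator with entries zeta_p f_p(x), where
    zeta_p ^ 2 = w ^ (p(p-1)/2) and f_p runs over random signs with mean
    correlation (1 - 2/b) ^ (Hamming distance).  These families commute up to
    O(1/b) in the normalised norm.

    Conjugation by the Fourier matrix and by diag(w ^ (p(p-1)/2)) acts on Weyl
    operators through SL_2(Z/m); a ping-pong argument shows that they form a
    quantum expander, uniformly in m.  Hence anything that almost commutes with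
    the F_k side is close to 1 (x) y, and y, almost commuting with all the signs
    f_p, is concentrated near the diagonal of X * X.  If the representation were
    close to a genuine one rho, this would apply to each rho(1, h); averaging the
    squared entries over h in F_m gives an almost invariant probability
    distribution near the diagonal of X * X, so that mu(W_i) + mu(W_j) is almost
    at least 1 for all i <> j, while the three W_i are disjoint. *)

(** * A tree-like space of walks *)

Definition colour := 'I_3.
Definition rword (w : seq colour) : bool := sorted (fun i j => i != j) w.

Lemma rword_rcons2 u j i :
  rword (rcons (rcons u j) i) = rword (rcons u j) && (j != i).
Proof.
case: u => [|k u]; rewrite /rword /=; first by rewrite andbT.
by rewrite rcons_path last_rcons.
Qed.

Lemma rword_rconsW u i : rword (rcons u i) -> rword u.
Proof. by rewrite /rword -cats1 => /cat_sorted2[]. Qed.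

Section Ball.
Variable r : nat.

Definition ball := {w : r.-bseq colour | rword w}.

(** Left multiplication by a generator of Z/2 * Z/2 * Z/2, truncated at length [r]: a word of full
    length that would grow stays fixed, which keeps the map an involution. *)
Definition push (i : colour) (w : seq colour) : seq colour :=
  if w is j :: w' then
    if j == i then w' else if size w < r then i :: w else w
  else if 0 < r then [:: i] else [::].

Lemma rword_push i w : rword w -> rword (push i w).
Proof.
case: w => [|j w] /=; first by case: ifP.
move=> h; case: ifP => [_|ji]; first by apply: path_sorted h.
by case: ifP => //= _; rewrite eq_sym ji.
Qed.

Lemma size_push i w : size w <= r -> size (push i w) <= r.
Proof.
case: w => [|j w] /=; first by case: ifP.
by case: ifP => _; [lia | case: ifP => //=].
Qed.

Lemma push_inv i w : rword w -> size w <= r -> push i (push i w) = w.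
Proof.
case: w => [|j w] /= h sz.
  by case: ifP => [r0|] /=; rewrite ?eqxx // => ->.
case: (eqVneq j i) h => [-> h|ji h].
  case: w h sz => [|k w] /=; first by move=> _ ->.
  by case/andP; rewrite eq_sym => /negbTE -> _ ->.
by case: ifP => [_|sr] /=; rewrite ?eqxx // (negbTE ji) sr.
Qed.

Definition ball_push (i : colour) (w : ball) : ball :=
  exist _ (@Bseq _ _ (push i (val w)) (size_push i (size_bseq (val w))))
    (rword_push i (valP w)).

Lemma ball_push_inv i : involutive (ball_push i).
Proof.
move=> w; apply/val_inj/val_inj => /=.
by rewrite push_inv ?(valP w) ?size_bseq.
Qed.

Definition pgen (i : colour) : {perm ball} := perm (inv_inj (ball_push_inv i)).

(** A right translation of the permutation group: the cubic graph is a Cayley graph, so short closed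
    walks need only be excluded at the identity. *)
Definition pmul (i : colour) (q : {perm ball}) : {perm ball} := (q * pgen i)%g.

Lemma pmul_inv i : involutive (pmul i).
Proof.
move=> q; rewrite /pmul -mulgA -[RHS]mulg1; congr mulg.
by apply/permP => w; rewrite permM !permE ball_push_inv.
Qed.

Lemma foldl_pmul u q :
  foldl (fun q i => pmul i q) q u = (q * foldl (fun q i => pmul i q) 1 u)%g.
Proof.
elim/last_ind: u => [|u i IH] /=; first by rewrite mulg1.
by rewrite !foldl_rcons IH /pmul mulgA.
Qed.

Definition ball0 : ball := exist _ (@Bseq r colour [::] isT) isT.

(** As long as its length stays within [r], a reduced word carries the empty word of the ball to its
    own reversal, so a nonempty one is not the identity permutation. *)
Lemma pmul_girth u q : rword u -> u != [::] -> size u <= r ->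
  foldl (fun q i => pmul i q) q u <> q.
Proof.
move=> ru u0 su; rewrite foldl_pmul -[RHS]mulg1 => /mulgI H.
have : val (val (foldl (fun q i => pmul i q) 1%g u ball0)) = rev u.
  elim/last_ind: u ru su {u0 H} => [|u i IH] ru su /=; first by rewrite perm1.
  rewrite foldl_rcons permM permE /= IH; last 2 first.
  - exact: rword_rconsW ru.
  - by move: su; rewrite size_rcons; apply: ltnW.
  rewrite rev_rcons; case/lastP: u ru su {IH} => [|u j] /=.
    by move=> _ ->.
  rewrite rev_rcons !size_rcons /= => ru su; rewrite size_rev.
  have -> : (j == i) = false.
    by apply/negbTE; move: ru; rewrite rword_rcons2 => /andP[].
  by rewrite su.
rewrite H perm1 /= => /esym/(congr1 size)/eqP.
by rewrite size_rev size_eq0 (negbTE u0).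
Qed.

End Ball.

Definition ham (E : finType) (c c' : E -> bool) : nat :=
  #|[pred h | c h != c' h]|.

(** * Edge-toggling walks on a graph of large girth *)

Section Walker.
Variables (Y : finType) (st : colour -> Y -> Y) (g : nat) (y0 : Y).
Hypothesis st_inv : forall i, involutive (st i).
Hypothesis girth : forall u q, rword u -> u != [::] -> size u <= g ->
  foldl (fun q i => st i q) q u <> q.
Hypothesis g_gt0 : 0 < g.

Notation halfedge := (Y * colour)%type.
Notation config := {ffun halfedge -> bool}.
Implicit Types (c : config) (q v : Y) (i j l : colour) (u : seq colour).

Definition vtx q u := foldl (fun q i => st i q) q u.

Lemma st_neq i q : st i q != q.
Proof. by apply/eqP; apply: (girth (u := [:: i])). Qed.

(** An edge is stored as its two half-edges, one at each endpoint, and both are flipped. *)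
Definition toggle c q i : config :=
  [ffun h => c h (+) ((h == (q, i)) || (h == (st i q, i)))].

Definition wstep (s : config * Y) i := (toggle s.1 s.2 i, st i s.2).

Definition walk (s : config * Y) u := foldl wstep s u.

Definition c0 : config := [ffun => false].

Lemma walk_rcons s u i : walk s (rcons u i) = wstep (walk s u) i.
Proof. by rewrite /walk foldl_rcons. Qed.

Lemma vtx_rcons q u i : vtx q (rcons u i) = st i (vtx q u).
Proof. by rewrite /vtx foldl_rcons. Qed.

Lemma walk_vtx s u : (walk s u).2 = vtx s.2 u.
Proof.
by elim/last_ind: u => //= u i IH; rewrite walk_rcons vtx_rcons /= IH.
Qed.

Lemma walk_support q u v l : (walk (c0, q) u).1 (v, l) ->
  exists2 k, k <= size u & v = vtx q (take k u).
Proof.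
elim/last_ind: u => [|u i IH]; first by rewrite ffunE.
rewrite walk_rcons /= ffunE.
case: (boolP ((walk (c0, q) u).1 (v, l))) => [/IH[k ku ->] _|/negbTE hf].
  exists k; first by rewrite size_rcons ltnW.
  by rewrite -cats1 takel_cat.
rewrite /= walk_vtx /= => /orP[]/eqP[-> _].
  by exists (size u); rewrite ?size_rcons // -cats1 takel_cat // take_size.
exists (size u).+1; rewrite ?size_rcons // -(size_rcons u i) take_size.
by rewrite /vtx foldl_rcons.
Qed.

(** An earlier visit to the final vertex would close a nonempty reduced walk of length at most [g],
    against the girth. Hence the last edge crossed is the only toggled edge there. *)
Lemma walk_end q u i l : rword (rcons u i) -> size u < g ->
  let s := walk (c0, q) (rcons u i) in s.1 (s.2, l) = (l == i).
Proof.
move=> ru su; rewrite walk_rcons /= ffunE.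
rewrite !xpair_eqE (negbTE (st_neq _ _)) eqxx /=.
case: (boolP ((walk (c0, q) u).1 _)) => // /walk_support[k ku h].
exfalso; apply: (girth (u := drop k (rcons u i)) (q := vtx q (take k u))).
- move: ru; rewrite /rword -{1}(cat_take_drop k (rcons u i)).
  by case/cat_sorted2.
- by rewrite -size_eq0 size_drop size_rcons subn_eq0 -ltnNge ltnS.
- by rewrite size_drop size_rcons (leq_trans (leq_subr _ _)).
rewrite -[RHS]h walk_vtx /= -/(vtx _ _).
have -> : take k u = take k (rcons u i) by rewrite -cats1 takel_cat.
rewrite /vtx -foldl_cat cat_take_drop foldl_rcons //.
Qed.

Definition degree_parity c v := c (v, inord 0) (+) c (v, inord 1) (+) c (v, inord 2).

(** The first clause says that the half-edges pair up to edges, the second that the edge set, as a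
    chain modulo 2, has boundary q + q'. *)
Definition path_like c q q' :=
  (forall v i, c (v, i) = c (st i v, i)) /\
  (forall v, degree_parity c v = (v == q) (+) (v == q')).

Lemma degree_parityE c v : degree_parity c v =
  \big[addb/false]_(l : colour) c (v, l).
Proof.
rewrite /degree_parity !big_ord_recl big_ord0 /= addbF addbA.
by do 2?[congr addb]; congr (c (v, _)); apply: val_inj; rewrite /= inordK.
Qed.

(** The toggled edge has boundary q + st i q, which moves one endpoint along it. *)
Lemma path_like_toggle c q q' i : path_like c q q' ->
  path_like (toggle c q i) (st i q) q'.
Proof.
case=> sy de; split=> [v j|v].
  rewrite !ffunE sy !xpair_eqE; congr addb.
  rewrite orbC; case: (eqVneq j i) => [->|_]; rewrite ?andbT ?andbF //.
  rewrite (inj_eq (inv_inj (st_inv i))).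
  have -> // : (st i v == q) = (v == st i q).
  by rewrite -{1}(st_inv i q) (inj_eq (inv_inj (st_inv i))).
have e : degree_parity (toggle c q i) v =
    degree_parity c v (+) ((v == q) || (v == st i q)).
  rewrite !degree_parityE.
  rewrite (eq_bigr (fun l => c (v, l) (+)
     (((v == q) || (v == st i q)) && (l == i)))); last first.
    by move=> l _; rewrite ffunE !xpair_eqE andb_orl.
  rewrite big_split /=; congr addb; rewrite (bigD1 i) //= eqxx andbT big1 ?addbF //.
  by move=> l /negbTE ->; rewrite andbF.
rewrite e de; case: (eqVneq v q) => [->|_] /=.
  have -> : (q == st i q) = false.
    by rewrite eq_sym; apply/negbTE/st_neq.
  by rewrite addbT negbK.
exact: addbC.
Qed.

Lemma toggleK c q i : toggle (toggle c q i) (st i q) i = c.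
Proof.
apply/ffunP => h; rewrite !ffunE st_inv orbC -addbA.
by rewrite addbb addbF.
Qed.

Definition csize c := #|[pred h | c h]|.

Lemma csize_toggle c q q' i : path_like c q q' -> c (q, i) ->
  csize (toggle c q i) < csize c.
Proof.
case=> sy _ ci; apply: proper_card; apply/properP; split.
  apply/subsetP => h; rewrite !inE ffunE.
  case: (eqVneq h (q, i)) => [->|_]; first by rewrite ci.
  case: (eqVneq h (st i q, i)) => [->|_]; first by rewrite -sy ci.
  by rewrite addbF.
by exists (q, i); rewrite !inE ?ffunE ?eqxx ?ci.
Qed.

(* A small edge set with boundary {q, q'} cannot contain a cycle, hence is the
   geodesic from q' to q; walking backwards from q along it recovers a word. *)
Lemma path_like_walk n c q q' : csize c <= n -> n < g -> path_like c q q' ->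
  exists u, [/\ rword u, size u <= n & walk (c0, q') u = (c, q)].
Proof.
elim: n c q q' => [|n IH] c q q' cn ng pl.
  have cf h : c h = false.
    by move: cn; rewrite leqn0 => /eqP/card0_eq/(_ h); rewrite inE.
  exists [::]; split=> //; congr pair; first by apply/ffunP => h; rewrite ffunE cf.
  have := pl.2 q; rewrite /degree_parity !cf eqxx /=.
  by case: eqP => // ->.
(* Cross an edge of [c] at [v], which removes it, apply induction to the smaller set, and append the
   reverse crossing. *)
have back v p i : c (v, i) -> path_like c v p ->
    exists u, [/\ rword u, u != [::], size u <= n.+1 & walk (c0, p) u = (c, v)].
  move=> cvi plv.
  have [u [ru su wu]] := IH (toggle c v i) (st i v) p
    (leq_trans (csize_toggle plv cvi) cn) (ltnW ng) (path_like_toggle i plv).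
  exists (rcons u i); split; last 1 first.
  - by rewrite walk_rcons wu /wstep /= toggleK st_inv.
  - case/lastP: u ru su wu => [|u j] // ru su wu.
    (* If the word already ended with [i], [walk_end] would put that edge into the remaining set,
       from which it has just been removed. *)
    have ji : j != i.
      apply/eqP => ji; move: su; rewrite size_rcons => su.
      have /= := walk_end p i ru (leq_trans su (ltnW (ltnW ng))).
      rewrite wu /= ffunE -plv.1 cvi !eqxx orbT ji eqxx //.
    by rewrite rword_rcons2 ru ji.
  - by case: (u).
  - by rewrite size_rcons.
case: (boolP (c == c0)) => [/eqP cc|].
  exists [::]; split=> //; rewrite cc; congr pair.
  have := pl.2 q; rewrite /degree_parity cc !ffunE eqxx /=.
  by case: eqP => // ->.
(* When q = q', any edge of [c] starts a closed reduced walk of length at most [n.+1], which the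
   girth excludes. *)
move=> cne; case: (eqVneq q q') => [qq|qq].
  exfalso; have [[v i] cvi] : exists h, c h.
    apply/existsP; apply: contraNT cne => /existsPn hn; apply/eqP/ffunP => h.
    by rewrite ffunE; apply/negbTE.
  have plv : path_like c v v.
    by split; [exact: pl.1 | move=> y; rewrite pl.2 qq !addbb].
  have [u [ru u0 su wu]] := back v v i cvi plv.
  apply: (girth (q := v) ru u0 (leq_trans su (ltnW ng))).
  by have := walk_vtx (c0, v) u; rewrite wu.
have [i ci] : exists i, c (q, i).
  apply/existsP; case: (boolP [exists i, c (q, i)]) => // /existsPn hn.
  have := pl.2 q; rewrite degree_parityE big1; last first.
    by move=> i _; apply/negbTE.
  by rewrite eqxx (negbTE qq).
by have [u [ru _ su wu]] := back q q' i ci pl; exists u.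
Qed.

(** An invariant of all states reachable from the empty edge set at [y0]. In the sum of two states
    [y0] cancels, leaving a chain that joins their two positions. *)
Definition good (s : config * Y) :=
  [forall v, forall i, s.1 (v, i) == s.1 (st i v, i)] &&
  [forall v, degree_parity s.1 v == (v == s.2) (+) (v == y0)].

Lemma goodP s : reflect (path_like s.1 s.2 y0) (good s).
Proof.
apply: (iffP andP) => [[/forallP h1 /forallP h2]|[h1 h2]]; split.
- by move=> v i; apply/eqP; move/forallP: (h1 v).
- by move=> v; apply/eqP.
- by apply/forallP => v; apply/forallP => i; rewrite h1.
- by apply/forallP => v; rewrite h2.
Qed.

Lemma good_wstep s i : good s -> good (wstep s i).
Proof. by move=> /goodP h; apply/goodP; apply: path_like_toggle. Qed.

Definition tspace := {s : config * Y | good s}.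

Definition tmove i (s : tspace) : tspace :=
  exist _ (wstep (val s) i) (good_wstep i (valP s)).

Lemma tmove_inv i : involutive (tmove i).
Proof.
move=> s; apply: val_inj => /=; case: (val s) => c q.
by rewrite /wstep /= toggleK st_inv.
Qed.

Definition tconf (s : tspace) : halfedge -> bool := (val s).1.

Lemma ham_tmove i s : ham (tconf (tmove i s)) (tconf s) <= 2.
Proof.
rewrite /ham; set q := (val s).2.
apply: leq_trans (subset_leq_card _) (_ : #|[set (q, i); (st i q, i)]| <= 2).
  apply/subsetP => h; rewrite !inE /tconf /= ffunE -/q.
  by case: (_ || _); rewrite // addbF eqxx.
by rewrite cards2; case: (_ != _).
Qed.

(** For nearby states this says that the path from [s'] to [s] ends with colour [i]. Only the
    position of [s] is inspected, so the sets for different colours are disjoint on all pairs, near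
    or far. *)
Definition last_edge i (s s' : tspace) : bool :=
  [forall l, (tconf s ((val s).2, l) (+) tconf s' ((val s).2, l)) == (l == i)].

Lemma last_edge_uniq i j s s' : last_edge i s s' -> last_edge j s s' -> i = j.
Proof.
move=> /forallP/(_ i)/eqP hi /forallP/(_ i)/eqP.
by rewrite hi eqxx => /esym/eqP.
Qed.

(** The difference of the two states is traced by a reduced word of length at most [K]. It does not
    end with [j], so appending [j] and then [i] keeps it reduced and shorter than the girth, and
    [walk_end] reads off its last letter. *)
Lemma last_edge_paradox K i j s s' : K + 2 < g -> i != j ->
  ham (tconf s) (tconf s') <= K -> ~~ last_edge j s s' ->
  last_edge i (tmove i (tmove j s)) s'.
Proof.
move=> Kg ij hK nj; pose c : config := [ffun h => tconf s h (+) tconf s' h].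
have pl : path_like c (val s).2 (val s').2.
  have [sy1 de1] := goodP _ (valP s); have [sy2 de2] := goodP _ (valP s').
  split=> [v l|v]; first by rewrite !ffunE /tconf sy1 sy2.
  have -> : degree_parity c v =
      degree_parity (val s).1 v (+) degree_parity (val s').1 v.
    by rewrite !degree_parityE -big_split /=;
      apply: eq_bigr => l _; rewrite ffunE.
  by rewrite de1 de2; case: (_ == _); case: (_ == _); case: (_ == _).
have sc : csize c <= K.
  apply: leq_trans hK; rewrite /csize /ham subset_leq_card //.
  by apply/subsetP => h; rewrite !inE ffunE; case: (tconf s h); case: (tconf s' h).
have Kg' : K < g by lia.
have [u [ru su wu]] := path_like_walk sc Kg' pl.
have rj : rword (rcons u j).
  case/lastP: u ru su wu => [|u k] // ru su wu.
  have kj : k != j.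
    apply: contra nj => /eqP kj; apply/forallP => l.
    move: su; rewrite size_rcons => su.
    have /= := walk_end (val s').2 l ru (leq_trans su (ltnW Kg')).
    by rewrite wu /= ffunE kj => ->.
  by rewrite rword_rcons2 ru kj.
have rji : rword (rcons (rcons u j) i).
  by rewrite rword_rcons2 rj eq_sym ij.
have wuji : walk (c0, (val s').2) (rcons (rcons u j) i) =
    ([ffun h => tconf (tmove i (tmove j s)) h (+) tconf s' h],
     (val (tmove i (tmove j s))).2).
  rewrite !walk_rcons wu /wstep /=; congr pair; apply/ffunP => h.
  by rewrite !ffunE /tconf /= !ffunE /= -[LHS]addbA [LHS]addbAC [in LHS]addbA.
apply/forallP => l; have /= := walk_end (val s').2 l rji.
have sg : size (rcons u j) < g.
  by rewrite size_rcons (leq_ltn_trans _ Kg) // addn2 !ltnS ltnW.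
by move=> /(_ sg); rewrite wuji /= ffunE => ->.
Qed.

Lemma good0 : good (c0, y0).
Proof.
apply/goodP; split=> [v i|v]; first by rewrite !ffunE.
by rewrite /degree_parity /= !ffunE [RHS]addbb.
Qed.

End Walker.

Lemma tree_like_space (K : nat) :
  exists (X : finType) (x0 : X) (mv : colour -> X -> X) (E : finType)
    (c : X -> E -> bool) (W : colour -> X -> X -> bool),
  [/\ forall i, involutive (mv i),
      forall i x, ham (c (mv i x)) (c x) <= 2,
      forall i j x y, W i x y -> W j x y -> i = j &
      forall i j x y, i != j -> ham (c x) (c y) <= K -> ~~ W j x y ->
        W i (mv i (mv j x)) y].
Proof.
(* The paradox extends words of length [K] by two letters and needs the result to be shorter than
   [g]. *)
pose r := K.+3; pose g := r.
have girth := @pmul_girth r; have inv := @pmul_inv r.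
pose y0 : {perm ball r} := 1%g.
have g0 : 0 < g by [].
pose X := tspace (@pmul r) y0.
pose x0 : X := exist (fun s => good (@pmul r) y0 s) (c0 _, y0) (good0 _ _).
pose E : finType := ({perm ball r} * colour)%type.
pose c : X -> E -> bool := @tconf _ _ _.
exists X, x0, (tmove inv girth g0), E, c, (@last_edge _ _ _); split.
- exact: tmove_inv.
- exact: ham_tmove.
- exact: last_edge_uniq.
- by move=> i j x y; apply: last_edge_paradox; rewrite addn2.
Qed.

Local Open Scope ring_scope.

(** * Frobenius norms and unitary matrices *)

Section SquaredModulus.
Variable R : realType.
Implicit Types (z w : R[i]).

Definition sqn z : R := complex.Re z ^+ 2 + complex.Im z ^+ 2.

Lemma sqn_ge0 z : 0 <= sqn z.
Proof. by rewrite addr_ge0 // sqr_ge0. Qed.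

Lemma sqn0 : sqn 0 = 0.
Proof. by rewrite /sqn /= expr0n addr0. Qed.

Lemma sqn1 : sqn 1 = 1.
Proof. by rewrite /sqn /= expr1n expr0n addr0. Qed.

Lemma sqnE z : (sqn z)%:C%C = z * Num.conj z.
Proof.
case: z => a b; rewrite /sqn /=.
by apply/eqP; rewrite eq_complex /=; apply/andP; split; apply/eqP; ring.
Qed.

Lemma sqnM z w : sqn (z * w) = sqn z * sqn w.
Proof. by case: z w => a b [c e]; rewrite /sqn /=; ring. Qed.

Lemma sqnN z : sqn (- z) = sqn z.
Proof. by case: z => a b; rewrite /sqn /=; ring. Qed.

Lemma sqnC z w : sqn (z - w) = sqn (w - z).
Proof. by rewrite -sqnN opprB. Qed.

Lemma sqn_conj z : sqn (Num.conj z) = sqn z.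
Proof. by case: z => a b; rewrite /sqn /=; ring. Qed.

Lemma sqn_real (r : R) : sqn r%:C%C = r ^+ 2.
Proof. by rewrite /sqn /=; ring. Qed.

Lemma sqn_ge_Re z : complex.Re z ^+ 2 <= sqn z.
Proof. by rewrite lerDl sqr_ge0. Qed.

(* (1 + s)|z|^2 + (1 + 1/s)|w|^2 - |z + w|^2 = |s z - w|^2 / s *)
Lemma sqnD_le (s : R) z w : 0 < s ->
  sqn (z + w) <= (1 + s) * sqn z + (1 + s^-1) * sqn w.
Proof.
move=> s0; case: z w => a b [c e]; rewrite /sqn /=.
rewrite -subr_ge0.
have -> : (1 + s) * (a ^+ 2 + b ^+ 2) + (1 + s^-1) * (c ^+ 2 + e ^+ 2) -
  ((a + c) ^+ 2 + (b + e) ^+ 2) = s^-1 * ((s * a - c) ^+ 2 + (s * b - e) ^+ 2).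
  by field; rewrite gt_eqF.
by rewrite mulr_ge0 ?invr_ge0 ?(ltW s0) // addr_ge0 // sqr_ge0.
Qed.

Lemma sqnB_le (s : R) z w : 0 < s ->
  sqn z <= (1 + s) * sqn w + (1 + s^-1) * sqn (z - w).
Proof. by move=> s0; rewrite -{1}(subrKC w z); apply: sqnD_le. Qed.

Lemma sqnD2_le z w : sqn (z + w) <= 2 * sqn z + 2 * sqn w.
Proof. by have := sqnD_le z w (@ltr01 R); rewrite invr1. Qed.

Lemma sqnD4_le z1 z2 z3 z4 : sqn (z1 + z2 + z3 + z4) <=
  4 * (sqn z1 + sqn z2 + sqn z3 + sqn z4).
Proof.
rewrite -(addrA (z1 + z2)).
have := sqnD2_le (z1 + z2) (z3 + z4).
by have := sqnD2_le z1 z2; have := sqnD2_le z3 z4; lra.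
Qed.

(** The squared norm is kept unnormalised, so smallness always means a small multiple of the
    dimension and no square roots occur. *)
Definition frob2 m n (A : 'M[R[i]]_(m, n)) : R := \sum_i \sum_j sqn (A i j).

Lemma frob2_ge0 m n (A : 'M[R[i]]_(m, n)) : 0 <= frob2 A.
Proof. by apply: sumr_ge0 => i _; apply: sumr_ge0 => j _; exact: sqn_ge0. Qed.

Lemma frob2N m n (A : 'M[R[i]]_(m, n)) : frob2 (- A) = frob2 A.
Proof. by apply: eq_bigr => i _; apply: eq_bigr => j _; rewrite mxE sqnN. Qed.

Lemma frob2C m n (A B : 'M[R[i]]_(m, n)) : frob2 (A - B) = frob2 (B - A).
Proof. by rewrite -frob2N opprB. Qed.

Lemma frob2D_le (s : R) m n (A B : 'M[R[i]]_(m, n)) : 0 < s ->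
  frob2 (A + B) <= (1 + s) * frob2 A + (1 + s^-1) * frob2 B.
Proof.
move=> s0; rewrite /frob2 !mulr_sumr -big_split /=; apply: ler_sum => i _.
rewrite !mulr_sumr -big_split /=; apply: ler_sum => j _.
by rewrite mxE; apply: sqnD_le.
Qed.

Lemma frob2B_le (s : R) m n (A B : 'M[R[i]]_(m, n)) : 0 < s ->
  frob2 A <= (1 + s) * frob2 B + (1 + s^-1) * frob2 (A - B).
Proof. by move=> s0; rewrite -{1}(subrKC B A); apply: frob2D_le. Qed.

Lemma frob2D2_le m n (A B : 'M[R[i]]_(m, n)) :
  frob2 (A + B) <= 2 * frob2 A + 2 * frob2 B.
Proof. by have := frob2D_le A B (@ltr01 R); rewrite invr1. Qed.

Lemma frob2B2_le m n (A B : 'M[R[i]]_(m, n)) :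
  frob2 (A - B) <= 2 * frob2 A + 2 * frob2 B.
Proof. by rewrite -(frob2N B); apply: frob2D2_le. Qed.

Lemma frob2_parallelogram m n (A B : 'M[R[i]]_(m, n)) :
  frob2 (A + B) + frob2 (A - B) = 2 * frob2 A + 2 * frob2 B.
Proof.
rewrite /frob2 !mulr_sumr -!big_split /=; apply: eq_bigr => i _.
rewrite !mulr_sumr -!big_split /=; apply: eq_bigr => j _; rewrite !mxE.
by case: (A i j) (B i j) => a b [c e]; rewrite /sqn /=; ring.
Qed.

Lemma frob2_entry m n (A : 'M[R[i]]_(m, n)) i j : sqn (A i j) <= frob2 A.
Proof.
rewrite /frob2 (bigD1 i) //= (bigD1 j) //= -addrA lerDl addr_ge0 //.
  by apply: sumr_ge0 => ? _; exact: sqn_ge0.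
by apply: sumr_ge0 => ? _; apply: sumr_ge0 => ? _; exact: sqn_ge0.
Qed.

Lemma frob2_block m1 m2 n1 n2 (A : 'M[R[i]]_(m1 + m2, n1 + n2)) :
  frob2 A = frob2 (ulsubmx A) + frob2 (ursubmx A)
            + (frob2 (dlsubmx A) + frob2 (drsubmx A)).
Proof.
rewrite /frob2 big_split_ord /= -!big_split /=.
by congr (_ + _); apply: eq_bigr => i _; rewrite big_split_ord /=;
  congr (_ + _); apply: eq_bigr => j _; rewrite !mxE.
Qed.

Lemma frob2_ulsubmx_le m1 m2 n1 n2 (A : 'M[R[i]]_(m1 + m2, n1 + n2)) :
  frob2 (ulsubmx A) <= frob2 A.
Proof.
rewrite (frob2_block A) -addrA lerDl !addr_ge0 //; exact: frob2_ge0.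
Qed.

Lemma adjmxK d (A : 'M[R[i]]_d) : adjmx (adjmx A) = A.
Proof. by apply/matrixP => i j; rewrite !mxE conjCK. Qed.

Lemma adjmxM d (A B : 'M[R[i]]_d) : adjmx (A *m B) = adjmx B *m adjmx A.
Proof. by rewrite /adjmx trmx_mul map_mxM. Qed.

Lemma adjmx1 d : adjmx 1%:M = 1%:M :> 'M[R[i]]_d.
Proof. by rewrite /adjmx trmx1 map_mx1. Qed.

Lemma frob2E d (A : 'M[R[i]]_d) : (frob2 A)%:C%C = \tr (A *m adjmx A).
Proof.
rewrite /frob2 raddf_sum /mxtrace /=; apply: eq_bigr => i _.
by rewrite raddf_sum /= !mxE; apply: eq_bigr => j _; rewrite !mxE sqnE.
Qed.

Lemma frob2_adj d (A : 'M[R[i]]_d) : frob2 (adjmx A) = frob2 A.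
Proof.
rewrite /frob2 exchange_big; apply: eq_bigr => i _; apply: eq_bigr => j _.
by rewrite !mxE sqn_conj.
Qed.

Section Unitary.
Variables (d : nat).
Implicit Types (U V A : 'M[R[i]]_d).

Lemma unitaryV U : unitary U -> adjmx U *m U = 1%:M.
Proof. exact: mulmx1C. Qed.

Lemma unitary1 : unitary (1%:M : 'M[R[i]]_d).
Proof. by rewrite /unitary adjmx1 mulmx1. Qed.

Lemma unitaryM U V : unitary U -> unitary V -> unitary (U *m V).
Proof.
move=> uU uV; rewrite /unitary adjmxM mulmxA -(mulmxA U) uV mulmx1; exact: uU.
Qed.

Lemma unitary_adj U : unitary U -> unitary (adjmx U).
Proof. by move=> uU; rewrite /unitary adjmxK; apply: unitaryV. Qed.

Lemma frob2_unitaryl U A : unitary U -> frob2 (U *m A) = frob2 A.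
Proof.
move=> uU; have H : ((frob2 (U *m A))%:C = (frob2 A)%:C)%C.
  by rewrite !frob2E adjmxM mulmxA mxtrace_mulC !mulmxA unitaryV // mul1mx.
by case: H.
Qed.

Lemma frob2_unitaryr U A : unitary U -> frob2 (A *m U) = frob2 A.
Proof.
move=> uU; rewrite -frob2_adj adjmxM frob2_unitaryl ?frob2_adj //.
exact: unitary_adj.
Qed.

Lemma frob2_unitary U : unitary U -> frob2 U = d%:R.
Proof.
move=> uU; have H : ((frob2 U)%:C = (d%:R)%:C)%C.
  by rewrite frob2E uU mxtrace1 rmorph_nat.
by case: H.
Qed.

Lemma unitary_row U i : unitary U -> \sum_j sqn (U i j) = 1.
Proof.
move=> uU; have /matrixP/(_ i i) := uU; rewrite !mxE eqxx.
move=> H; have : ((\sum_j sqn (U i j))%:C = 1%:C)%C.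
  rewrite raddf_sum /= -[RHS]H; apply: eq_bigr => j _.
  by rewrite !mxE sqnE.
by case.
Qed.

Lemma unitary_col U j : unitary U -> \sum_i sqn (U i j) = 1.
Proof.
move=> uU; rewrite -[RHS](unitary_row j (unitary_adj uU)).
by apply: eq_bigr => i _; rewrite !mxE sqn_conj.
Qed.

End Unitary.

Lemma hs_norm_frob2 d (A : 'M[R[i]]_d) : hs_norm A = Num.sqrt (d%:R^-1 * frob2 A).
Proof. by []. Qed.

End SquaredModulus.

(** * Roots of unity *)

Section RootOfUnity.
Variables (R : realType).

Definition cis (t : R) : R[i] := (cos t +i* sin t)%C.

Lemma sqn_cis t : sqn (cis t) = 1.
Proof. by rewrite /sqn /= cos2Dsin2. Qed.

Lemma cisD s t : cis (s + t) = cis s * cis t.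
Proof.
by apply/eqP; rewrite eq_complex /= cosD sinD; apply/andP; split;
  apply/eqP; ring.
Qed.

Lemma cisX t k : cis t ^+ k = cis (t * k%:R).
Proof.
elim: k => [|k IH].
  rewrite expr0 mulr0 /cis cos0 sin0; apply/eqP.
  by rewrite eq_complex /= !eqxx.
by rewrite exprS IH -cisD -natr1; congr cis; ring.
Qed.

Lemma cis_2pi : cis (pi *+ 2) = 1.
Proof. by rewrite /cis cos2pi sin2pi; apply/eqP; rewrite eq_complex /= !eqxx. Qed.

Variable m : nat.
Hypothesis m_gt0 : (0 < m)%N.

Let m0 : 0 < m%:R :> R. Proof. by rewrite ltr0n. Qed.

Definition uroot : R[i] := cis (pi *+ 2 / m%:R).

Lemma urootX k : uroot ^+ k = cis (pi *+ 2 * (k%:R / m%:R)).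
Proof. by rewrite cisX; congr cis; ring. Qed.

Lemma uroot_unit : sqn uroot = 1. Proof. exact: sqn_cis. Qed.

Lemma uroot_m : uroot ^+ m = 1.
Proof. by rewrite urootX divff ?gt_eqF // mulr1 cis_2pi. Qed.

(** By the half-angle formula, real part 1 would make the sine of half the angle vanish, but that
    half lies strictly between 0 and pi. *)
Lemma uroot_prim k : (0 < k < m)%N -> uroot ^+ k != 1.
Proof.
case/andP=> k0 km; rewrite urootX; apply/eqP => /(congr1 (@complex.Re R)) /=.
have -> : pi *+ 2 * (k%:R / m%:R) = (pi * (k%:R / m%:R)) *+ 2 :> R.
  by ring.
rewrite cos_mulr2n => h.
have s0 : 0 < sin (pi * (k%:R / m%:R)) :> R.
  apply: sin_gt0_pi; rewrite mulr_gt0 ?pi_gt0 ?divr_gt0 ?ltr0n //=.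
  by rewrite -[ltRHS]mulr1 ltr_pM2l ?pi_gt0 // ltr_pdivrMr // mul1r ltr_nat.
have := cos2Dsin2 (pi * (k%:R / m%:R) : R); have := exprn_gt0 2 s0.
by move: h; rewrite mulr2n; lra.
Qed.

(** The angle lies between pi/2 and 3pi/2. Consequently |w^k - 1|^2 is at least 2 for these
    exponents. *)
Lemma uroot_mid k : (m <= 4 * k <= 3 * m)%N -> complex.Re (uroot ^+ k) <= 0.
Proof.
case/andP=> h1 h2; rewrite urootX /=; set x := k%:R / m%:R : R.
have x1 : 1 <= 4 * x.
  by rewrite /x mulrA ler_pdivlMr // mul1r -natrM ler_nat.
have x2 : 4 * x <= 3.
  by rewrite /x mulrA ler_pdivrMr // -!natrM ler_nat.
have -> : cos (pi *+ 2 * x) = - cos (pi *+ 2 * x - pi).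
  by rewrite cosB cospi sinpi; ring.
rewrite oppr_le0 cos_ge0_pihalf //; have p0 := pi_gt0 R.
have g1 : 0 <= pi * (4 * x - 1) by apply: mulr_ge0; [exact: ltW | rewrite subr_ge0].
have g2 : 0 <= pi * (3 - 4 * x) by apply: mulr_ge0; [exact: ltW | rewrite subr_ge0].
by clearbody x; apply/andP; split; lra.
Qed.

End RootOfUnity.

(** * A quantum expander *)

Section MassTransport.
Variables (R : realType) (I : finType).
Implicit Types (A B : {set I}).

Definition mass (u : I -> R[i]) A : R := \sum_(z in A) sqn (u z).

Lemma mass_ge0 u A : 0 <= mass u A.
Proof. by apply: sumr_ge0 => z _; exact: sqn_ge0. Qed.

Lemma mass_subset u A B : A \subset B -> mass u A <= mass u B.
Proof.
move=> sAB; rewrite /mass [leRHS](big_setID A) /= (setIidPr sAB) lerDl.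
exact: mass_ge0.
Qed.

Lemma mass_setU u A B : mass u (A :|: B) <= mass u A + mass u B.
Proof.
have -> : mass u (A :|: B) = mass u A + mass u (B :\: A).
  rewrite /mass (big_setID A) /=; congr (_ + _); apply: eq_bigl => z;
  by rewrite !inE; case: (z \in A); case: (z \in B).
by rewrite lerD2l mass_subset // subsetDl.
Qed.

Lemma mass_disjoint u A B : [disjoint A & B] ->
  mass u (A :|: B) = mass u A + mass u B.
Proof. by move=> dAB; rewrite /mass -bigU //; apply: eq_bigl => z; rewrite !inE. Qed.

Variables (u theta : I -> R[i]) (g : I -> I) (G : R).
Hypothesis g_inj : injective g.
Hypothesis theta1 : forall z, sqn (theta z) = 1.
Hypothesis near : \sum_z sqn (u z - theta z * u (g z)) <= G.

Lemma mass_near A : \sum_(z in A) sqn (u z - theta z * u (g z)) <= G.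
Proof.
apply: le_trans near; rewrite [leRHS](bigID (mem A)) /= lerDl.
by apply: sumr_ge0 => z _; exact: sqn_ge0.
Qed.

Lemma mass_image A : mass u (g @: A) = \sum_(z in A) sqn (u (g z)).
Proof. by rewrite /mass big_imset //= => x y _ _; exact: g_inj. Qed.

(** Phases do not change masses, so near-invariance of [u] under [g] makes the masses of a set and
    its image comparable; [s] trades the multiplicative loss against the additive error. *)
Lemma mass_le_image (s : R) A : 0 < s ->
  mass u A <= (1 + s) * mass u (g @: A) + (1 + s^-1) * G.
Proof.
move=> s0; apply: le_trans (_ : (1 + s) * mass u (g @: A) + (1 + s^-1) *
  \sum_(z in A) sqn (u z - theta z * u (g z)) <= _).
  rewrite mass_image !mulr_sumr -big_split /=; apply: ler_sum => z _.
  have := sqnB_le (u z) (theta z * u (g z)) s0.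
  by rewrite sqnM theta1 mul1r.
rewrite lerD2l ler_wpM2l ?mass_near // addr_ge0 // invr_ge0; exact: ltW.
Qed.

Lemma mass_image_le (s : R) A : 0 < s ->
  mass u (g @: A) <= (1 + s) * mass u A + (1 + s^-1) * G.
Proof.
move=> s0; apply: le_trans (_ : (1 + s) * mass u A + (1 + s^-1) *
  \sum_(z in A) sqn (u z - theta z * u (g z)) <= _).
  rewrite mass_image !mulr_sumr -big_split /=; apply: ler_sum => z _.
  have := sqnB_le (theta z * u (g z)) (u z) s0.
  by rewrite sqnM theta1 mul1r (sqnC (theta z * _)).
rewrite lerD2l ler_wpM2l ?mass_near // addr_ge0 // invr_ge0; exact: ltW.
Qed.

End MassTransport.

(** * Weyl operators and the action of SL_2(Z/m) *)

Section Weyl.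
Variables (R : realType) (m' : nat).
Notation m := m'.+1.
Hypothesis m_odd : odd m.
Variable w : R[i].
Hypothesis w_unit : sqn w = 1.
Hypothesis wm : w ^+ m = 1.
Hypothesis w_prim : forall k, (0 < k < m)%N -> w ^+ k != 1.
Hypothesis w_mid : forall k, (m <= 4 * k <= 3 * m)%N -> complex.Re (w ^+ k) <= 0.
Implicit Types (p q a b : 'I_m) (x : 'M[R[i]]_m).

Let sqn_w k : sqn (w ^+ k) = 1.
Proof. by elim: k => [|k IH]; rewrite ?expr0 ?sqn1 // exprS sqnM w_unit mul1r. Qed.

Let conj_w k : Num.conj (w ^+ k) * w ^+ k = 1.
Proof. by rewrite mulrC -sqnE sqn_w. Qed.

Let w_mod k : w ^+ (k %% m) = w ^+ k.
Proof. exact: expr_mod. Qed.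

Definition chi p q : R[i] := w ^+ (p * q).
(** A quadratic character of Z/m whose polarisation is [chi], see [tauD]. *)
Definition tau p : R[i] := w ^+ 'C(p, 2).

Lemma sqn_chi p q : sqn (chi p q) = 1. Proof. exact: sqn_w. Qed.
Lemma sqn_tau p : sqn (tau p) = 1. Proof. exact: sqn_w. Qed.
Lemma chiC p q : chi p q = chi q p. Proof. by rewrite /chi mulnC. Qed.

Lemma chiDl p q a : chi (p + q) a = chi p a * chi q a.
Proof. by rewrite /chi /= -exprD -mulnDl -w_mod modnMml w_mod. Qed.

Lemma chiDr p q a : chi a (p + q) = chi a p * chi a q.
Proof. by rewrite !(chiC a) chiDl. Qed.

Lemma chi0 a : chi 0 a = 1.
Proof. by rewrite /chi /= mul0n. Qed.

Lemma conj_chiK p q : Num.conj (chi p q) * chi p q = 1.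
Proof. exact: conj_w. Qed.

Lemma conj_chi p q : Num.conj (chi p q) = chi (- p) q.
Proof.
have nz : chi p q != 0.
  apply/eqP => h; have := conj_chiK p q.
  by rewrite h mulr0 => /esym/eqP; rewrite oner_eq0.
by apply: (mulIf nz); rewrite conj_chiK -chiDl addNr chi0.
Qed.

Lemma conj_chir p q : Num.conj (chi p q) = chi p (- q).
Proof. by rewrite chiC conj_chi chiC. Qed.

Lemma binD2 i j : 'C(i + j, 2) = ('C(i, 2) + 'C(j, 2) + i * j)%N.
Proof.
elim: j => [|j IH]; first by rewrite muln0 !addn0.
by rewrite addnS !binS IH !bin1 mulnS; lia.
Qed.

Lemma w_binD i j :
  w ^+ 'C(i + j, 2) = w ^+ 'C(i, 2) * w ^+ 'C(j, 2) * w ^+ (i * j).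
Proof. by rewrite binD2 !exprD. Qed.

Lemma w_mulm k : w ^+ (m * k) = 1.
Proof. by rewrite exprM wm expr1n. Qed.

(** For odd m the number C(m, 2) is a multiple of m; this is where oddness enters. *)
Lemma w_bin2_mod k : w ^+ 'C(k %% m, 2) = w ^+ 'C(k, 2).
Proof.
have w1 : w ^+ 'C(m, 2) = 1.
  have -> : 'C(m, 2) = (m * m'./2)%N.
    have e : m' = (2 * m'./2)%N.
      rewrite mul2n -[LHS]odd_double_half; move: m_odd; rewrite oddS.
      by move=> /negbTE ->.
    by rewrite bin2 -pred_Sn -divn2 [X in (m * X)%N]e mulnCA mulKn.
  exact: w_mulm.
have wmm j : w ^+ 'C(m * j, 2) = 1.
  elim: j => [|j IH]; first by rewrite muln0 expr0.
  by rewrite mulnS w_binD IH w1 w_mulm !mulr1.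
rewrite [in RHS](divn_eq k m) mulnC w_binD wmm mul1r.
by rewrite -mulnA w_mulm mulr1.
Qed.

Lemma tauD p a : tau (p + a) = tau p * tau a * chi p a.
Proof. by rewrite /tau /chi -w_binD -[RHS]w_bin2_mod. Qed.

(** Formally (-a)(-a-1)/2 = a(a-1)/2 + a. This failure of evenness drives [near_clock]. *)
Lemma tauN a : tau (- a) = tau a * w ^+ a.
Proof.
have nz : tau a * chi (- a) a != 0.
  apply/eqP => h; have : sqn (tau a * chi (- a) a) = 1.
    by rewrite sqnM sqn_tau sqn_chi mulr1.
  by rewrite h sqn0 => /esym/eqP; rewrite oner_eq0.
apply: (mulIf nz); rewrite mulrA -tauD addNr.
have -> : tau 0 = 1 by rewrite /tau /= bin0n expr0.
have -> : tau a * w ^+ a * (tau a * chi (- a) a) =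
  tau a * tau a * w ^+ a * chi (- a) a by ring.
have -> : tau a * tau a * w ^+ a = chi a a.
  rewrite /tau /chi -!exprD; congr (w ^+ _).
  move: (nat_of_ord a) => k.
  by elim: k => // k IH; rewrite !binS !bin1 mulSn mulnS; lia.
by rewrite -chiDl addrN chi0.
Qed.

Lemma sum_chi p : \sum_q chi p q = m%:R *+ (p == 0).
Proof.
case: eqP => [->|/eqP p0].
  by rewrite (eq_bigr (fun=> 1)) ?sumr_const ?card_ord // => q _; rewrite chi0.
have h : (w ^+ p - 1) * \sum_q chi p q = 0.
  rewrite (eq_bigr (fun q : 'I_m => (w ^+ p) ^+ q)); last first.
    by move=> q _; rewrite /chi exprM.
  by rewrite -subrX1 -exprM mulnC exprM wm expr1n subrr.
have nz : w ^+ p - 1 != 0.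
  rewrite subr_eq0 w_prim // ltn_ord andbT lt0n; apply: contra p0 => /eqP h0.
  by apply/eqP/val_inj.
by move/eqP: h; rewrite mulf_eq0 (negbTE nz) => /eqP ->.
Qed.

Definition shear_mx : 'M[R[i]]_m := \matrix_(p, q) (tau p *+ (p == q)).
Definition root_m : R := Num.sqrt (m%:R).
Definition dft_mx : 'M[R[i]]_m := \matrix_(p, q) (chi p q * (root_m^-1)%:C%C).

Lemma sqr_root_m : (root_m^-1)%:C%C * (root_m^-1)%:C%C = (m%:R)^-1 :> R[i].
Proof.
rewrite -rmorphM /= -invfM -expr2 sqr_sqrtr ?ler0n // fmorphV rmorph_nat //.
Qed.

Lemma m_neq0 : (m%:R : R[i]) != 0.
Proof. by rewrite pnatr_eq0. Qed.

Lemma unitary_shear : unitary shear_mx.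
Proof.
apply/matrixP => p q; rewrite !mxE (bigD1 p) //= big1 ?addr0; last first.
  by move=> r rp; rewrite !mxE eq_sym (negbTE rp) mulr0n mul0r.
rewrite !mxE eqxx mulr1n eq_sym; case: eqP => [->|_].
  by rewrite mulr1n -sqnE sqn_tau.
by rewrite mulr0n rmorph0 mulr0.
Qed.

Lemma conj_real (r : R) : Num.conj (r%:C%C) = r%:C%C :> R[i].
Proof. by apply/eqP; rewrite eq_complex /= oppr0 !eqxx. Qed.

Lemma unitary_dft : unitary dft_mx.
Proof.
apply/matrixP => p q; rewrite !mxE.
rewrite (eq_bigr (fun r => (m%:R)^-1 * chi (p - q) r)); last first.
  move=> r _; rewrite !mxE rmorphM /= conj_real conj_chi chiDl -sqr_root_m.
  by ring.
by rewrite -mulr_sumr sum_chi subr_eq0; case: eqP => _;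
  rewrite ?mulr0n ?mulr0 // mulr1n mulVf // m_neq0.
Qed.

(** The coefficient of [x] at the Weyl operator with shift [z.1] and frequency [z.2]. *)
Definition weyl x (z : 'I_m * 'I_m) : R[i] :=
  (m%:R)^-1 * \sum_p Num.conj (chi p z.2) * x p (p + z.1).

Lemma weylB x y z : weyl (x - y) z = weyl x z - weyl y z.
Proof.
rewrite /weyl -mulrBr -sumrB; congr (_ * _); apply: eq_bigr => p _.
by rewrite !mxE mulrBr.
Qed.

(** The cyclic diagonals partition the entries of [x], and along each of them the coefficients form
    a rescaled unitary Fourier transform. *)
Lemma weyl_parseval x : \sum_z sqn (weyl x z) = (m%:R)^-1 * frob2 x.
Proof.
pose Y : 'M[R[i]]_m := \matrix_(p, a) x p (p + a).
have -> : frob2 x = frob2 Y.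
  apply: eq_bigr => p _; rewrite (reindex_inj (addrI p)) /=.
  by apply: eq_bigr => a _; rewrite mxE.
rewrite -(frob2_unitaryl Y (unitary_adj unitary_dft)).
rewrite -(pair_big xpredT xpredT (fun a b => sqn (weyl x (a, b)))) /=.
rewrite exchange_big /= /frob2 mulr_sumr; apply: eq_bigr => b _.
rewrite mulr_sumr; apply: eq_bigr => a _.
have -> : weyl x (a, b) = (root_m^-1)%:C%C * (adjmx dft_mx *m Y) b a.
  rewrite /weyl !mxE /= -sqr_root_m -mulrA; congr (_ * _).
  rewrite mulr_sumr; apply: eq_bigr => p _; rewrite !mxE rmorphM /= conj_real.
  by ring.
by rewrite sqnM sqn_real exprVn sqr_sqrtr // ler0n.
Qed.

(** Elements of SL_2(Z/m): [tmap] and [jmap] come from conjugation by the diagonal and the Fourier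
    matrix, while the opposite shear [smap] is reached through the relation tmap jmap smap =
    jmap. *)
Definition tmap (z : 'I_m * 'I_m) : 'I_m * 'I_m := (z.1, z.1 + z.2).
Definition jmap (z : 'I_m * 'I_m) : 'I_m * 'I_m := (- z.2, z.1).
Definition smap (z : 'I_m * 'I_m) : 'I_m * 'I_m := (z.1 + z.2, z.2).

Lemma weyl_shear x z :
  weyl (shear_mx *m x *m adjmx shear_mx) z
  = Num.conj (tau z.1) * weyl x (tmap z).
Proof.
case: z => a b; rewrite /weyl /tmap /= mulrCA; congr (_ * _).
rewrite mulr_sumr; apply: eq_bigr => p _.
have -> : (shear_mx *m x *m adjmx shear_mx) p (p + a) =
  tau p * x p (p + a) * Num.conj (tau (p + a)).
  rewrite !mxE (bigD1 (p + a)) //= big1 ?addr0; last first.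
    by move=> q qa; rewrite !mxE eq_sym (negbTE qa) mulr0n rmorph0 mulr0.
  rewrite !mxE eqxx mulr1n (bigD1 p) //= big1 ?addr0; last first.
    by move=> q qa; rewrite !mxE eq_sym (negbTE qa) mulr0n mul0r.
  by rewrite !mxE eqxx mulr1n.
rewrite tauD !rmorphM /= chiDr rmorphM /=.
have h : tau p * Num.conj (tau p) = 1 by rewrite -sqnE sqn_tau.
transitivity ((tau p * Num.conj (tau p)) * (Num.conj (chi p b) *
  (x p (p + a)) * (Num.conj (tau a) * Num.conj (chi p a)))).
  by ring.
by rewrite h; ring.
Qed.

Lemma weyl_dft x z :
  weyl (dft_mx *m x *m adjmx dft_mx) z = chi z.1 z.2 * weyl x (jmap z).
Proof.
case: z => a b; rewrite /weyl /jmap /= mulrCA; congr (_ * _).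
transitivity (\sum_p \sum_p' \sum_q'
   (m%:R)^-1 * (chi p (p' - q' - b) * Num.conj (chi a q') * x p' q')).
  apply: eq_bigr => p _; rewrite !mxE.
  rewrite mulr_sumr exchange_big /=; apply: eq_bigr => q' _.
  rewrite !mxE mulr_suml mulr_sumr; apply: eq_bigr => p' _.
  rewrite !mxE chiDl !rmorphM /= conj_real !chiDr -!conj_chir -sqr_root_m.
  by ring.
transitivity (\sum_p' \sum_q' (m%:R)^-1 * ((\sum_p chi (p' - q' - b) p) *
   (Num.conj (chi a q') * x p' q'))).
  rewrite exchange_big /=; apply: eq_bigr => p' _.
  rewrite exchange_big /=; apply: eq_bigr => q' _.
  rewrite -mulr_sumr; congr (_ * _); rewrite mulr_suml.
  by apply: eq_bigr => p _; rewrite chiC mulrA.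
rewrite mulr_sumr; apply: eq_bigr => p' _.
(* By orthogonality of characters, the sum over [p] leaves only the term with q' = p' - b. *)
rewrite (bigD1 (p' - b)) //= [X in _ + X]big1 ?addr0; last first.
  move=> q' hq; rewrite sum_chi; case: eqP => [h|_].
    by case/eqP: hq; apply/eqP; rewrite eq_sym -subr_eq0 addrAC h.
  by rewrite mulr0n mul0r mulr0.
rewrite sum_chi opprB addrA addrAC subrr add0r subrr eqxx mulr1n.
rewrite mulrA mulVf ?m_neq0 // mul1r chiDr rmorphM /= -conj_chir conjCK.
by rewrite (chiC a p'); ring.
Qed.

Section Gap.
Variable x : 'M[R[i]]_m.
Let u := weyl x.
Let G : R := (m%:R)^-1 *
  (frob2 (x *m shear_mx - shear_mx *m x) + frob2 (x *m dft_mx - dft_mx *m x)).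

Lemma gap_term U (K : R) : unitary U -> 0 <= K ->
  (m%:R)^-1 * frob2 (x - U *m x *m adjmx U)
  <= (m%:R)^-1 * (frob2 (x *m U - U *m x) + K).
Proof.
move=> uU K0; rewrite ler_wpM2l ?invr_ge0 ?ler0n //.
rewrite -(frob2_unitaryr _ uU) mulmxBl -!mulmxA unitaryV // mulmx1.
by rewrite lerDl.
Qed.

Lemma near_shear : \sum_z sqn (u z - Num.conj (tau z.1) * u (tmap z)) <= G.
Proof.
rewrite (eq_bigr (fun z => sqn (weyl (x - shear_mx *m x *m adjmx shear_mx) z))).
  rewrite weyl_parseval; apply: gap_term; first exact: unitary_shear.
  exact: frob2_ge0.
by move=> z _; rewrite weylB weyl_shear.
Qed.

Lemma near_dft : \sum_z sqn (u z - chi z.1 z.2 * u (jmap z)) <= G.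
Proof.
rewrite (eq_bigr (fun z => sqn (weyl (x - dft_mx *m x *m adjmx dft_mx) z))).
  rewrite weyl_parseval /G [X in _ <= _ * X]addrC; apply: gap_term.
    exact: unitary_dft.
  exact: frob2_ge0.
by move=> z _; rewrite weylB weyl_dft.
Qed.

Lemma jmap_inj : injective jmap.
Proof. move=> [a b] [c e] h; have h1 : - b = - e := congr1 fst h.
have h2 : a = c := congr1 snd h; by rewrite (oppr_inj h1) h2. Qed.

Lemma tmap_inj : injective tmap.
Proof. move=> [a b] [c e] h; have h1 : a = c := congr1 fst h.
have h2 : a + b = c + e := congr1 snd h; rewrite -h1 in h2 *.
by rewrite (addrI _ h2). Qed.

Let opp2 (z : 'I_m * 'I_m) : 'I_m * 'I_m := (- z.1, - z.2).

Lemma opp2_inj : injective opp2.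
Proof. move=> [a b] [c e] h; have h1 : - a = - c := congr1 fst h.
have h2 : - b = - e := congr1 snd h.
by rewrite (oppr_inj h1) (oppr_inj h2). Qed.

(** [jmap] applied twice is negation, and the two phases cancel. *)
Lemma near_parity : \sum_z sqn (u z - u (opp2 z)) <= 4 * G.
Proof.
have H2 : \sum_z sqn (u (jmap z) - chi (jmap z).1 (jmap z).2 * u (opp2 z)) <= G.
  apply: le_trans near_dft; rewrite [leRHS](reindex_inj jmap_inj) /=.
  by apply: ler_sum => z _; rewrite /jmap /opp2.
have := near_dft; move: H2; set A := \sum_z _; set B := \sum_z _ => HA HB.
suff : \sum_z sqn (u z - u (opp2 z)) <= 2 * B + 2 * A by lra.
rewrite !mulr_sumr -big_split /=; apply: ler_sum => z _.
have -> : u z - u (opp2 z) = (u z - chi z.1 z.2 * u (jmap z)) +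
  chi z.1 z.2 * (u (jmap z) - chi (jmap z).1 (jmap z).2 * u (opp2 z)).
  have h : chi z.1 z.2 * chi (jmap z).1 (jmap z).2 = 1.
    by rewrite /jmap /= -conj_chi (chiC z.2) mulrC conj_chiK.
  by rewrite -[X in u z - X]mul1r -h; ring.
by apply: le_trans (sqnD2_le _ _) _; rewrite sqnM sqn_chi mul1r.
Qed.

(** Comparing [near_shear] at z and at -z, and using that [u] is almost even, shows that (tau(a) -
    tau(-a)) u is small up to conjugation, with a the first coordinate. By [tauN] the modulus of
    this factor is |w^a - 1|. The four errors add up to 4 (1 + 4 + 1 + 4) G. *)
Lemma near_clock : \sum_(z : 'I_m * 'I_m) sqn (w ^+ z.1 - 1) * sqn (u z) <= 40 * G.
Proof.
rewrite (reindex_inj tmap_inj) /=.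
pose a1 z := sqn (u z - Num.conj (tau z.1) * u (tmap z)).
have h1 : \sum_z a1 z <= G := near_shear.
have h2 : \sum_z sqn (u z - u (opp2 z)) <= 4 * G := near_parity.
have h3 : \sum_z a1 (opp2 z) <= G.
  by apply: le_trans h1; rewrite [leRHS](reindex_inj opp2_inj).
have h4 : \sum_z sqn (u (tmap z) - u (opp2 (tmap z))) <= 4 * G.
  apply: le_trans h2; rewrite [leRHS](reindex_inj tmap_inj) /=; exact: lexx.
suff H : \sum_(z : 'I_m * 'I_m) sqn (w ^+ z.1 - 1) * sqn (u (tmap z)) <=
   4 * (\sum_z a1 z + \sum_z sqn (u z - u (opp2 z)) + \sum_z a1 (opp2 z) +
   \sum_z sqn (u (tmap z) - u (opp2 (tmap z)))).
  by apply: le_trans H _; move: h1 h2 h3 h4; lra.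
rewrite -!big_split /= mulr_sumr; apply: ler_sum => z _.
set ta := Num.conj (tau z.1); set tb := Num.conj (tau (- z.1)).
have -> : sqn (w ^+ z.1 - 1) * sqn (u (tmap z)) =
    sqn ((ta - tb) * u (tmap z)).
  rewrite [RHS]sqnM; congr (_ * _); rewrite /ta /tb tauN -rmorphB /= sqn_conj.
  have -> : tau z.1 - tau z.1 * w ^+ z.1 = tau z.1 * (1 - w ^+ z.1) by ring.
  by rewrite sqnM sqn_tau mul1r sqnC.
have -> : (ta - tb) * u (tmap z) = - (u z - ta * u (tmap z)) +
   (u z - u (opp2 z)) + (u (opp2 z) - tb * u (tmap (opp2 z))) +
   (- tb) * (u (tmap z) - u (opp2 (tmap z))).
  have -> : opp2 (tmap z) = tmap (opp2 z).
    by rewrite /opp2 /tmap /= opprD.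
  by ring.
apply: le_trans (sqnD4_le _ _ _ _) _.
rewrite sqnN sqnM sqnN /tb sqn_conj sqn_tau mul1r; exact: lexx.
Qed.

Definition mid (a : 'I_m) := (m <= 4 * a <= 3 * m)%N.
Definition outA : {set 'I_m * 'I_m} := [set z | mid z.1].
Definition outB : {set 'I_m * 'I_m} := [set z | mid z.2].
(** A half-open quadrant of small vectors: its four rotations under [jmap] cover every nonzero
    vector with neither coordinate in the middle range. *)
Definition quad : {set 'I_m * 'I_m} :=
  [set z : 'I_m * 'I_m | [&& 0 < z.1, 4 * z.1 < m & 4 * z.2 < m]%N].

Lemma mass_outA : mass u outA <= 20 * G.
Proof.
suff : 2 * mass u outA <= 40 * G by lra.
apply: le_trans near_clock; rewrite /mass mulr_sumr.
rewrite [leRHS](bigID (mem outA)) /= -[leLHS]addr0; apply: lerD.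
  apply: ler_sum => z; rewrite inE => zmid.
  rewrite ler_wpM2r ?sqn_ge0 //.
  have := sqn_w z.1; have := w_mid zmid; move: (w ^+ z.1) => [c e].
  by rewrite /sqn /= => c0; lra.
by apply: sumr_ge0 => z _; rewrite mulr_ge0 ?sqn_ge0.
Qed.

Lemma valD_small (a b : 'I_m) : (a + b < m)%N -> (a + b)%R = (a + b)%N :> nat.
Proof. by move=> h /=; rewrite modn_small. Qed.

Lemma valN (a : 'I_m) : (- a)%R = (if a == 0 :> nat then 0 else m - a)%N :> nat.
Proof.
rewrite /=; case: (nat_of_ord a) (ltn_ord a) => [|k] hk.
  by rewrite subn0 modnn.
by rewrite modn_small //=; lia.
Qed.

Lemma outB_sub : outB \subset jmap @: outA.
Proof.
apply/subsetP => -[a b]; rewrite inE /= => bm; apply/imsetP.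
by exists (b, - a); rewrite ?inE // /jmap /= opprK.
Qed.

Lemma tquad_sub : tmap @: quad \subset quad :|: outB.
Proof.
apply/subsetP => z /imsetP[[a b] ab ->]; move: ab.
rewrite inE => /and3P[/= a0 am bm].
have e : (a + b)%R = (a + b)%N :> nat by apply: valD_small; lia.
by rewrite !inE /mid -[(tmap _).2]/((a + b)%R) -[(tmap _).1]/(a) e; lia.
Qed.

Lemma squad_sub : smap @: quad \subset quad :|: outA.
Proof.
apply/subsetP => z /imsetP[[a b] ab ->]; move: ab.
rewrite inE => /and3P[/= a0 am bm].
have e : (a + b)%R = (a + b)%N :> nat by apply: valD_small; lia.
by rewrite !inE /mid -[(smap _).2]/(b) -[(smap _).1]/((a + b)%R) e; lia.
Qed.

(** The ping-pong step: on the image under [tmap] the second coordinate is at least the first, on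
    the image under [smap] it is strictly smaller. *)
Lemma quad_disjoint : [disjoint tmap @: quad & smap @: quad].
Proof.
rewrite -setI_eq0; apply/eqP/setP => z; rewrite !inE; apply/negP.
case/andP => /imsetP[[a b] ab ->]; move: ab.
rewrite inE => /and3P[/= a0 am bm].
case/imsetP => [[c e]]; rewrite inE => /and3P[/= c0 cm em].
case=> [/(congr1 (@nat_of_ord _)) + /(congr1 (@nat_of_ord _))].
rewrite !valD_small; lia.
Qed.

Lemma quad_cover (a b : 'I_m) : (a, b) != (0, 0) ->
  [|| mid a, mid b, (a, b) \in quad, (b, - a) \in quad, (- a, - b) \in quad
    | (- b, a) \in quad].
Proof.
move=> nz; have {}nz : ~~ ((a == 0 :> nat) && (b == 0 :> nat)).
  apply: contra nz => /andP[/eqP a0 /eqP b0]; apply/eqP.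
  by congr pair; apply: val_inj.
rewrite !inE /mid [snd _]/= [fst _]/= !valN.
have := ltn_ord a; have := ltn_ord b; move: nz.
move: (nat_of_ord a) (nat_of_ord b) => i j.
by case: eqP => /= hi; case: eqP => /= hj; lia.
Qed.

Definition off0 : {set 'I_m * 'I_m} := [set z : 'I_m * 'I_m | z != (0, 0)].

Lemma cover : off0 \subset (outA :|: outB) :|: (quad :|: jmap @: quad
  :|: jmap @: (jmap @: quad) :|: jmap @: (jmap @: (jmap @: quad))).
Proof.
apply/subsetP => -[a b]; rewrite inE => /quad_cover.
have j1 : (a, b) = jmap (b, - a) by rewrite /jmap /= opprK.
have j2 : (a, b) = jmap (jmap (- a, - b)) by rewrite /jmap /= !opprK.
have j3 : (a, b) = jmap (jmap (jmap (- b, a))) by rewrite /jmap /= !opprK.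
case/or4P => [ma|mb|q|/or3P[] q]; rewrite !in_setU.
- by rewrite inE ma.
- by rewrite [_ \in outB]inE mb orbT.
- by rewrite q !orbT.
- by rewrite [in X in _ || (_ || X || _ || _)]j1 imset_f ?orbT.
- by rewrite [in X in _ || (_ || _ || X || _)]j2 !imset_f ?orbT.
- by rewrite [in X in _ || (_ || _ || _ || X)]j3 !imset_f ?orbT.
Qed.

(** Two disjoint images of [quad], each of nearly the same mass as [quad], lie in [quad] up to sets
    of mass O(G). Hence [quad] itself has mass O(G), and so do its rotations, which with those sets
    cover everything off the origin. *)
Lemma mass_off_origin : mass u off0 <= 2000 * G.
Proof.
(* The comparison costs one factor 9/8 for [tmap] and three for [smap]; as 8/9 + (8/9)^3 > 1, the
   mass of [quad] can be absorbed. *)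
have s0 : 0 < 8^-1 :> R by lra.
have cj (z : 'I_m * 'I_m) : sqn (chi z.1 z.2) = 1 by exact: sqn_chi.
have ct (z : 'I_m * 'I_m) : sqn (Num.conj (tau z.1) : R[i]) = 1.
  by rewrite sqn_conj sqn_tau.
have J1 (A : {set 'I_m * 'I_m}) :
    mass u (jmap @: A) <= (1 + 8^-1) * mass u A + (1 + 8) * G.
  by have := mass_image_le jmap_inj cj near_dft A s0; rewrite invrK.
have J2 (A : {set 'I_m * 'I_m}) :
    mass u A <= (1 + 8^-1) * mass u (jmap @: A) + (1 + 8) * G.
  by have := mass_le_image jmap_inj cj near_dft A s0; rewrite invrK.
have T1 (A : {set 'I_m * 'I_m}) :
    mass u (tmap @: A) <= (1 + 8^-1) * mass u A + (1 + 8) * G.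
  by have := mass_image_le tmap_inj ct near_shear A s0; rewrite invrK.
have T2 (A : {set 'I_m * 'I_m}) :
    mass u A <= (1 + 8^-1) * mass u (tmap @: A) + (1 + 8) * G.
  by have := mass_le_image tmap_inj ct near_shear A s0; rewrite invrK.
have hA := mass_outA.
have hB : mass u outB <= (1 + 8^-1) * mass u outA + (1 + 8) * G.
  by apply: le_trans (J1 outA); apply: mass_subset; exact: outB_sub.
have hQt := T2 quad.
have e : tmap @: (jmap @: (smap @: quad)) = jmap @: quad.
  rewrite -!imset_comp; apply: eq_imset => -[a b].
  by rewrite /tmap /jmap /smap /= addrC addrK.
have hQ1 := J2 quad; rewrite -e in hQ1.
have hQ2 := T1 (jmap @: (smap @: quad)).
have hQ3 := J1 (smap @: quad).
have hdis := mass_disjoint u quad_disjoint.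
have hsub : mass u (tmap @: quad :|: smap @: quad) <=
    mass u quad + (mass u outA + mass u outB).
  apply: le_trans (_ : mass u (quad :|: (outA :|: outB)) <= _).
    apply: mass_subset; rewrite subUset.
    rewrite (subset_trans tquad_sub) ?setUS ?subsetUr //.
    by rewrite (subset_trans squad_sub) ?setUS ?subsetUl.
  apply: le_trans (mass_setU _ _ _) _; rewrite lerD2l; exact: mass_setU.
have h1 := J1 quad; have h2 := J1 (jmap @: quad).
have h3 := J1 (jmap @: (jmap @: quad)).
have hc := mass_subset u cover.
have c1 := mass_setU u (outA :|: outB) (quad :|: jmap @: quad
  :|: jmap @: (jmap @: quad) :|: jmap @: (jmap @: (jmap @: quad))).
have c2 := mass_setU u outA outB.
have c3 := mass_setU u (quad :|: jmap @: quad :|: jmap @: (jmap @: quad))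
  (jmap @: (jmap @: (jmap @: quad))).
have c4 := mass_setU u (quad :|: jmap @: quad) (jmap @: (jmap @: quad)).
have c5 := mass_setU u quad (jmap @: quad).
have g0 : 0 <= G.
  by rewrite mulr_ge0 ?invr_ge0 ?ler0n // addr_ge0 ?frob2_ge0.
by lra.
Qed.

End Gap.

(** A scalar matrix has its only Weyl coefficient at the origin, where the coefficient of [x] is its
    normalised trace; Parseval then converts [mass_off_origin]. The constant is independent of m. *)
Theorem quantum_expander (x : 'M[R[i]]_m) :
  frob2 (x - (\tr x / m%:R)%:M) <= 2000 *
    (frob2 (x *m shear_mx - shear_mx *m x) + frob2 (x *m dft_mx - dft_mx *m x)).
Proof.
have wc c (z : 'I_m * 'I_m) : weyl c%:M z = c *+ (z == (0, 0)).
  case: z => a b; rewrite /weyl /=.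
  rewrite (eq_bigr (fun p => chi (- b) p * (c *+ (a == 0)))); last first.
    move=> p _; rewrite !mxE conj_chir chiC.
    by rewrite -subr_eq0 opprD addrA subrr add0r oppr_eq0.
  rewrite -mulr_suml sum_chi oppr_eq0 xpair_eqE.
  case: (b == 0); rewrite ?mulr0n ?mul0r ?mulr0 ?andbF //.
  by rewrite andbT mulr1n mulrA mulVf ?m_neq0 // mul1r.
have m0 : 0 < (m%:R : R)^-1 by rewrite invr_gt0 ltr0n.
rewrite -(ler_pM2l m0) [leRHS]mulrCA -weyl_parseval.
rewrite (bigD1 (0, 0)) //= weylB wc eqxx mulr1n.
have -> : weyl x (0, 0) = \tr x / m%:R.
  rewrite /weyl mulrC; congr (_ / _); apply: eq_bigr => p _.
  by rewrite /= chiC chi0 rmorph1 mul1r addr0.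
rewrite subrr sqn0 add0r; apply: le_trans (mass_off_origin x).
rewrite /mass le_eqVlt; apply/orP; left; apply/eqP.
by apply: eq_big => z; rewrite ?inE // => z0; rewrite weylB wc (negbTE z0) subr0.
Qed.



End Weyl.

(** * The almost commuting matrices *)

Lemma ham_triangle (E : finType) (c1 c2 c3 : E -> bool) :
  (ham c1 c3 <= ham c1 c2 + ham c2 c3)%N.
Proof.
rewrite /ham -cardUI; apply: leq_trans (leq_addr _ _).
apply: subset_leq_card; apply/subsetP => h; rewrite !inE.
by case: (c1 h); case: (c2 h); case: (c3 h).
Qed.

Lemma frob2_scalar (R : realType) n (a : R[i]) :
  frob2 (a%:M : 'M_n) = n%:R * sqn a.
Proof.
rewrite /frob2 (eq_bigr (fun=> sqn a)); last first.
  move=> p _; rewrite (bigD1 p) //= big1 ?addr0; first by rewrite mxE eqxx mulr1n.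
  by move=> q qp; rewrite mxE eq_sym (negbTE qp) mulr0n sqn0.
by rewrite sumr_const card_ord mulr_natl.
Qed.

Section Signs.
Variables (R : realType) (X E : finType) (c : X -> E -> bool) (b' : nat).
Notation b := b'.+1.
Notation J := {ffun E -> 'I_b}.

(** A uniform [j] marks each e independently with probability 1/b; the sign is the parity of the
    number of marked elements of [c x]. *)
Definition rsign (x : X) (j : J) : R :=
  \prod_e (if c x e && (j e == ord0) then -1 else 1).

Lemma rsign_sqr x j : rsign x j ^+ 2 = 1.
Proof.
rewrite expr2 -big_split /= big1 // => e _.
by case: ifP => _; ring.
Qed.

(** The average factorises over e. Each e on which [c x] and [c y] differ contributes the mean 1 -
    2/b of a single sign, every other one contributes 1. *)
Lemma rsign_correlation x y : (0 < b')%N ->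
  \sum_j rsign x j * rsign y j = #|J|%:R * (1 - 2 / b%:R) ^+ ham (c x) (c y).
Proof.
move=> b0; have bn0 : (b%:R : R) != 0 by rewrite pnatr_eq0.
pose F e (v : 'I_b) : R := (if c x e && (v == ord0) then -1 else 1) *
  (if c y e && (v == ord0) then -1 else 1).
rewrite (eq_bigr (fun j : J => \prod_e F e (j e))); last first.
  by move=> j _; rewrite -big_split.
rewrite -(bigA_distr_bigA F).
have Fe e : \sum_v F e v = b%:R * (if c x e != c y e then 1 - 2 / b%:R else 1).
  rewrite big_ord_recl (eq_bigr (fun=> 1)); last first.
    by move=> v _; rewrite /F !andbF mulr1.
  rewrite sumr_const card_ord /F eqxx !andbT.
  move: bn0; rewrite -[b%:R]natr1 => bn0.
  by case: (c x e); case: (c y e) => /=; field.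
rewrite (eq_bigr _ (fun e _ => Fe e)) big_split /= prodr_const.
rewrite card_ffun card_ord natrX; congr (_ * _).
by rewrite -big_mkcond /= prodr_const.
Qed.

(** The sample space itself indexes the signs. Its cardinality is a power of the odd number b, hence
    odd as the Weyl calculus requires. *)
Lemma sign_family : (0 < b')%N -> odd b ->
  exists m' (f : 'I_m'.+1 -> X -> R),
  [/\ odd m'.+1, forall p x, f p x ^+ 2 = 1 &
    forall x y, \sum_p f p x * f p y =
      m'.+1%:R * (1 - 2 / b%:R) ^+ ham (c x) (c y)].
Proof.
move=> b0 bodd; have J0 : (0 < #|J|)%N.
  by rewrite card_ffun card_ord expn_gt0.
exists #|J|.-1; have eJ : #|J|.-1.+1 = #|J| by rewrite prednK.
exists (fun p x => rsign x (enum_val (cast_ord eJ p))); split.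
- by rewrite eJ card_ffun card_ord oddX bodd orbT.
- by move=> p x; exact: rsign_sqr.
- move=> x y; rewrite [in RHS]eJ -rsign_correlation //.
  rewrite [RHS](reindex (enum_val (A := J))) /=; last first.
    exact/onW_bij/enum_val_bij.
  rewrite [RHS](reindex (cast_ord eJ)) //=.
  by exists (cast_ord (esym eJ)) => p _; rewrite ?cast_ordK ?cast_ordKV.
Qed.

End Signs.

(** * The unitaries on C^m (x) l^2(X) *)

Section Model.
Variables (R : realType) (X E : finType) (c : X -> E -> bool) (m' : nat).
Notation m := m'.+1.
Variables (f : 'I_m -> X -> R) (theta : R).
Hypothesis m_odd : odd m.
Hypothesis f_sqr : forall p x, f p x ^+ 2 = 1.
Hypothesis f_corr : forall x y,
  \sum_p f p x * f p y = m%:R * theta ^+ ham (c x) (c y).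

Definition site := ('I_m * X)%type.
Notation dim := #|{: site}|.
Definition ix (z : site) : 'I_dim := enum_rank z.

Lemma sum_ix (T : nmodType) (F : 'I_dim -> T) : \sum_i F i = \sum_z F (ix z).
Proof. by rewrite (reindex ix) //; exact/onW_bij/enum_rank_bij. Qed.

Lemma frob2_ix (A : 'M[R[i]]_dim) :
  frob2 A = \sum_z \sum_z' sqn (A (ix z) (ix z')).
Proof. by rewrite /frob2 sum_ix; apply: eq_bigr => z _; rewrite sum_ix. Qed.

Definition kmx (k : site -> site -> R[i]) : 'M[R[i]]_dim :=
  \matrix_(i, j) k (enum_val i) (enum_val j).

Lemma kmxE k z z' : kmx k (ix z) (ix z') = k z z'.
Proof. by rewrite mxE !enum_rankK. Qed.

Lemma ix_surj i : exists z, i = ix z.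
Proof. by exists (enum_val i); rewrite /ix enum_valK. Qed.

Lemma kmx_eq (A B : 'M[R[i]]_dim) :
  (forall z z', A (ix z) (ix z') = B (ix z) (ix z')) -> A = B.
Proof.
move=> h; apply/matrixP => i j.
by have [z ->] := ix_surj i; have [z' ->] := ix_surj j.
Qed.

Lemma mxBE m0 n0 (A B : 'M[R[i]]_(m0, n0)) i j : (A - B) i j = A i j - B i j.
Proof. by rewrite !mxE. Qed.

Lemma mulmx_ix (A B : 'M[R[i]]_dim) z z' :
  (A *m B) (ix z) (ix z') = \sum_y A (ix z) (ix y) * B (ix y) (ix z').
Proof. by rewrite mxE sum_ix. Qed.

Lemma adjmx_ix (A : 'M[R[i]]_dim) z z' :
  adjmx A (ix z) (ix z') = Num.conj (A (ix z') (ix z)).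
Proof. by rewrite !mxE. Qed.

Lemma one_ix z z' : (1%:M : 'M[R[i]]_dim) (ix z) (ix z') = (z == z')%:R.
Proof. by rewrite mxE (inj_eq enum_rank_inj). Qed.

Let w : R[i] := uroot R m.
Let w1 : sqn w = 1. Proof. exact: uroot_unit. Qed.
Let wm : w ^+ m = 1. Proof. exact: uroot_m. Qed.
Let wp k : (0 < k < m)%N -> w ^+ k != 1. Proof. exact: uroot_prim. Qed.
Let wmid k : (m <= 4 * k <= 3 * m)%N -> complex.Re (w ^+ k) <= 0.
Proof. exact: uroot_mid. Qed.

(* A square root of the entry w ^+ 'C(p, 2) of the shear matrix. *)
Definition zeta (p : 'I_m) : R[i] := cis (pi / m%:R) ^+ 'C(p, 2).

Lemma zeta_sqr p : zeta p ^+ 2 = tau w p.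
Proof.
rewrite /zeta /tau /w /uroot -exprM mulnC exprM; congr (_ ^+ _).
by rewrite expr2 -cisD; congr cis; ring.
Qed.

Lemma sqn_zeta p : sqn (zeta p) = 1.
Proof. by rewrite /zeta cisX sqn_cis. Qed.

Definition dg (z : site) : R[i] := zeta z.1 * (f z.1 z.2)%:C%C.

Lemma sqn_dg z : sqn (dg z) = 1.
Proof. by rewrite /dg sqnM sqn_zeta sqn_real f_sqr mul1r. Qed.

(** Squaring erases the signs, so the single unitary [U1] carries both the signs and, through its
    square, the shear matrix of the expander. *)
Lemma dg_sqr z : dg z ^+ 2 = tau w z.1.
Proof.
by rewrite /dg exprMn zeta_sqr -rmorphXn /= f_sqr rmorph1 mulr1.
Qed.

Definition U1 : 'M[R[i]]_dim := kmx (fun z z' => dg z *+ (z == z')).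
Definition U2 : 'M[R[i]]_dim :=
  kmx (fun z z' => dft_mx m' w z.1 z'.1 *+ (z.2 == z'.2)).
Definition Vp (g : X -> X) : 'M[R[i]]_dim :=
  kmx (fun z z' => ((z == (z'.1, g z'.2)) : nat)%:R).

Lemma mulU1 (A : 'M[R[i]]_dim) z z' :
  (U1 *m A) (ix z) (ix z') = dg z * A (ix z) (ix z').
Proof.
rewrite mulmx_ix (bigD1 z) //= big1 ?addr0 => [|y yz].
  by rewrite kmxE eqxx mulr1n.
by rewrite kmxE eq_sym (negbTE yz) mulr0n mul0r.
Qed.

Lemma mulrU1 (A : 'M[R[i]]_dim) z z' :
  (A *m U1) (ix z) (ix z') = A (ix z) (ix z') * dg z'.
Proof.
rewrite mulmx_ix (bigD1 z') //= big1 ?addr0 => [|y yz].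
  by rewrite kmxE eqxx mulr1n.
by rewrite kmxE (negbTE yz) mulr0n mulr0.
Qed.

Lemma sum_site (F : site -> R[i]) : \sum_z F z = \sum_x \sum_p F (p, x).
Proof.
rewrite exchange_big /= (eq_bigr (fun z : site => F (z.1, z.2))).
  by rewrite -(pair_big xpredT xpredT (fun p x => F (p, x))).
by move=> [p x].
Qed.

Lemma mulU2 (A : 'M[R[i]]_dim) z z' :
  (U2 *m A) (ix z) (ix z') = \sum_p dft_mx m' w z.1 p * A (ix (p, z.2)) (ix z').
Proof.
rewrite mulmx_ix sum_site (bigD1 z.2) //= [X in _ + X]big1 ?addr0 => [|x xz].
  by apply: eq_bigr => p _; rewrite kmxE /= eqxx mulr1n.
by rewrite big1 // => p _; rewrite kmxE /= eq_sym (negbTE xz) mulr0n mul0r.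
Qed.

Lemma mulrU2 (A : 'M[R[i]]_dim) z z' :
  (A *m U2) (ix z) (ix z') = \sum_p A (ix z) (ix (p, z'.2)) * dft_mx m' w p z'.1.
Proof.
rewrite mulmx_ix sum_site (bigD1 z'.2) //= [X in _ + X]big1 ?addr0 => [|x xz].
  by apply: eq_bigr => p _; rewrite kmxE /= eqxx mulr1n.
by rewrite big1 // => p _; rewrite kmxE /= (negbTE xz) mulr0n mulr0.
Qed.

Lemma mulVp g (A : 'M[R[i]]_dim) z z' : injective g ->
  (Vp g *m A) (ix (z.1, g z.2)) (ix z') = A (ix z) (ix z').
Proof.
move=> gi; rewrite mulmx_ix (bigD1 z) //= big1 ?addr0 => [|y yz].
  by rewrite kmxE eqxx mul1r.
rewrite kmxE; case: eqP => [[h1 /gi h2]|_]; last by rewrite mul0r.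
by case/eqP: yz; rewrite (surjective_pairing y) (surjective_pairing z) h1 h2.
Qed.

Lemma mulrVp g (A : 'M[R[i]]_dim) z z' :
  (A *m Vp g) (ix z) (ix z') = A (ix z) (ix (z'.1, g z'.2)).
Proof.
rewrite mulmx_ix (bigD1 (z'.1, g z'.2)) //= big1 ?addr0 => [|y yz].
  by rewrite kmxE eqxx mulr1.
by rewrite kmxE (negbTE yz) mulr0.
Qed.

Lemma unitary_U1 : unitary U1.
Proof.
apply: kmx_eq => z z'; rewrite mulU1 adjmx_ix one_ix kmxE eq_sym.
case: eqP => [->|_]; first by rewrite mulr1n -sqnE sqn_dg.
by rewrite mulr0n rmorph0 mulr0.
Qed.

Lemma unitary_U2 : unitary U2.
Proof.
apply: kmx_eq => -[p x] [q y]; rewrite mulU2 one_ix xpair_eqE /=.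
have /matrixP/(_ p q) := unitary_dft w1 wm wp.
rewrite [X in X = _]mxE [X in _ = X]mxE => h.
case: (eqVneq x y) => [->|xy].
  rewrite andbT -h; apply: eq_bigr => r _; congr (_ * _).
  by rewrite adjmx_ix kmxE /= eqxx mulr1n [RHS]mxE [in RHS]mxE.
rewrite andbF big1 // => r _.
by rewrite adjmx_ix kmxE /= eq_sym (negbTE xy) mulr0n rmorph0 mulr0.
Qed.

Lemma unitary_Vp g : injective g -> unitary (Vp g).
Proof.
move=> gi; apply: kmx_eq => z z'.
have [h gK hK] := injF_bij gi.
have -> : z = ((z.1, h z.2).1, g (z.1, h z.2).2).
  by rewrite /= hK -surjective_pairing.
rewrite mulVp // adjmx_ix one_ix kmxE /= hK -surjective_pairing.
rewrite rmorph_nat eq_sym; congr (nat_of_bool _)%:R.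
Qed.

Lemma VpM g h : Vp g *m Vp h = Vp (g \o h).
Proof. by apply: kmx_eq => z z'; rewrite mulrVp !kmxE. Qed.

Lemma Vp_ext g h : g =1 h -> Vp g = Vp h.
Proof. by move=> gh; apply: kmx_eq => z z'; rewrite !kmxE gh. Qed.

Lemma commU2 g : injective g -> U2 *m Vp g = Vp g *m U2.
Proof.
move=> gi; apply: kmx_eq => -[p x] [q y].
have [h gK hK] := injF_bij gi.
rewrite mulrVp kmxE /=.
have -> : (p, x) = ((p, h x).1, g (p, h x).2) by rewrite /= hK.
by rewrite mulVp // kmxE /= -{1}(hK x) (inj_eq gi).
Qed.

Lemma f_dist x y : \sum_p (f p x - f p y) ^+ 2 =
  2 * m%:R * (1 - theta ^+ ham (c x) (c y)).
Proof.
have -> : \sum_p (f p x - f p y) ^+ 2 =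
    \sum_(p < m) 2 - 2 * \sum_p f p x * f p y.
  rewrite mulr_sumr -sumrB; apply: eq_bigr => p _.
  by have := f_sqr p x; have := f_sqr p y; rewrite !expr2 => h1 h2; lra.
by rewrite f_corr sumr_const card_ord -mulr_natr; ring.
Qed.

Lemma sqn_dgB p x y : sqn (dg (p, x) - dg (p, y)) = (f p x - f p y) ^+ 2.
Proof. by rewrite /dg /= -mulrBr -rmorphB /= sqnM sqn_zeta mul1r sqn_real. Qed.

Lemma sum_siteR (F : site -> R) : \sum_z F z = \sum_x \sum_p F (p, x).
Proof.
rewrite exchange_big /= (eq_bigr (fun z : site => F (z.1, z.2))).
  by rewrite -(pair_big xpredT xpredT (fun p x => F (p, x))).
by move=> [p x].
Qed.

(** The commutator is supported on the entries from (p, x) to (p, g x), where it is a difference of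
    two signs. *)
Lemma commU1 g : injective g ->
  frob2 (U1 *m Vp g - Vp g *m U1) =
  \sum_x 2 * m%:R * (1 - theta ^+ ham (c (g x)) (c x)).
Proof.
move=> gi; rewrite frob2_ix exchange_big /= sum_siteR.
apply: eq_bigr => x _; rewrite -f_dist; apply: eq_bigr => p _.
rewrite (bigD1 (p, g x)) //= big1 ?addr0.
  by rewrite mxBE mulU1 mulrU1 kmxE eqxx mulr1 mul1r sqn_dgB.
move=> z zg; rewrite mxBE mulU1 mulrU1 kmxE (negbTE zg).
by rewrite mulr0 mul0r subrr sqn0.
Qed.

(** * Concentration near the diagonal of matrices almost commuting with U1 and U2 *)

Section FarMass.
Variables (A : 'M[R[i]]_dim) (K : nat).
Hypothesis theta_K : forall h, (K <= h)%N -> theta ^+ h <= 1 / 2.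

Let blk x y : 'M[R[i]]_m := \matrix_(p, q) A (ix (p, x)) (ix (q, y)).
Let y_ x y : R[i] := \tr (blk x y) / m%:R.
Let A1 := frob2 (A *m U1 - U1 *m A).
Let A2 := frob2 (A *m U2 - U2 *m A).

Lemma frob2_blocks (B : 'M[R[i]]_dim) : frob2 B =
  \sum_x \sum_y \sum_p \sum_q sqn (B (ix (p, x)) (ix (q, y))).
Proof.
rewrite frob2_ix sum_siteR; apply: eq_bigr => x _.
rewrite [RHS]exchange_big /=; apply: eq_bigr => p _; exact: sum_siteR.
Qed.

(** Passing from [U1] to its square multiplies each entry of the commutator by u + v with |u| = |v|
    = 1, hence the factor 4. *)
Lemma blk_shear : \sum_x \sum_y
  frob2 (blk x y *m shear_mx m' w - shear_mx m' w *m blk x y) <= 4 * A1.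
Proof.
rewrite /A1 frob2_blocks mulr_sumr; apply: ler_sum => x _.
rewrite mulr_sumr; apply: ler_sum => y _.
rewrite mulr_sumr; apply: ler_sum => p _.
rewrite mulr_sumr; apply: ler_sum => q _.
rewrite !mxBE mulU1 mulrU1 [(blk x y *m _) _ _]mxE [(_ *m blk x y) _ _]mxE.
rewrite (bigD1 q) //= big1 ?addr0 => [|r rq]; last first.
  by rewrite !mxE (negbTE rq) mulr0n mulr0.
rewrite (bigD1 p) //= big1 ?addr0 => [|r rp]; last first.
  by rewrite !mxE eq_sym (negbTE rp) mulr0n mul0r.
rewrite !mxE !eqxx !mulr1n -(dg_sqr (p, x)) -(dg_sqr (q, y)).
set a := A _ _; set u := dg (p, x); set v := dg (q, y).
have -> : a * v ^+ 2 - u ^+ 2 * a = (u + v) * (a * v - u * a) by ring.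
rewrite sqnM ler_wpM2r ?sqn_ge0 //.
by have := sqnD2_le u v; rewrite /u /v !sqn_dg; lra.
Qed.

Lemma blk_dft : \sum_x \sum_y
  frob2 (blk x y *m dft_mx m' w - dft_mx m' w *m blk x y) = A2.
Proof.
rewrite /A2 frob2_blocks; apply: eq_bigr => x _; apply: eq_bigr => y _.
apply: eq_bigr => p _; apply: eq_bigr => q _.
rewrite !mxBE mulU2 mulrU2 /=.
rewrite [(blk x y *m _) _ _]mxE [(_ *m blk x y) _ _]mxE.
by congr (sqn (_ - _)); apply: eq_bigr => r _; rewrite [blk x y _ _]mxE.
Qed.

Let dl := \sum_x \sum_y frob2 (blk x y - (y_ x y)%:M).

Lemma dl_le : dl <= 2000 * (4 * A1 + A2).
Proof.
apply: le_trans (_ : _ <= 2000 * (\sum_x \sum_y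
  frob2 (blk x y *m shear_mx m' w - shear_mx m' w *m blk x y) + \sum_x \sum_y
  frob2 (blk x y *m dft_mx m' w - dft_mx m' w *m blk x y))) _; last first.
  by rewrite blk_dft ler_wpM2l ?ler0n // lerD2r blk_shear.
rewrite -big_split /= mulr_sumr; apply: ler_sum => x _.
rewrite -big_split /= mulr_sumr; apply: ler_sum => y _.
exact: (quantum_expander m_odd w1 wm wp wmid).
Qed.

(** On the diagonal of a block, the commutator with [U1] is nearly the trace average times a
    difference of signs; the sum over p of the squared differences is [f_dist]. *)
Lemma diag_mass : \sum_x \sum_y
    2 * m%:R * (1 - theta ^+ ham (c x) (c y)) * sqn (y_ x y)
  <= 2 * A1 + 8 * dl.
Proof.
rewrite /A1 /dl frob2_blocks !mulr_sumr -big_split; apply: ler_sum => x _ /=.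
rewrite !mulr_sumr -big_split; apply: ler_sum => y _ /=.
rewrite -f_dist mulr_suml /frob2 !mulr_sumr -big_split; apply: ler_sum => p _ /=.
apply: le_trans (_ : 2 * sqn ((A *m U1 - U1 *m A) (ix (p, x)) (ix (p, y)))
  + 8 * sqn ((blk x y - (y_ x y)%:M) p p) <= _); last first.
  apply: lerD; rewrite ler_wpM2l // (bigD1 p) //= lerDl;
  by apply: sumr_ge0 => q _; exact: sqn_ge0.
rewrite -sqn_dgB !mxBE mulrU1 mulU1 [blk x y p p]mxE [_%:M _ _]mxE eqxx mulr1n.
set a := A _ _; set u := dg (p, x); set v := dg (p, y); set z := y_ x y.
have -> : sqn (u - v) * sqn z = sqn (- (a * v - u * a) + (v - u) * (a - z)).
  by rewrite -sqnM; congr sqn; ring.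
apply: le_trans (sqnD2_le _ _) _; rewrite sqnN lerD2l sqnM.
have h : sqn (v - u) <= 4.
  by have := sqnD2_le v (- u); rewrite sqnN /u /v !sqn_dg; lra.
by have := sqn_ge0 (a - z); nra.
Qed.

(** Each block is near its scalar part by the expander. For far pairs 1 - theta^h is at least 1/2,
    so [diag_mass] controls the scalar part too. *)
Lemma far_mass : \sum_x \sum_(y | (K <= ham (c x) (c y))%N) \sum_p \sum_q
    sqn (A (ix (p, x)) (ix (q, y))) <= 1000 * 200 * (A1 + A2).
Proof.
apply: le_trans (_ : _ <= 2 * dl + 2 * \sum_x \sum_y
    2 * m%:R * (1 - theta ^+ ham (c x) (c y)) * sqn (y_ x y)) _; last first.
  have := diag_mass; have := dl_le.
  have := frob2_ge0 (A *m U1 - U1 *m A); have := frob2_ge0 (A *m U2 - U2 *m A).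
  by rewrite -/A1 -/A2; lra.
rewrite /dl !mulr_sumr -big_split; apply: ler_sum => x _ /=.
rewrite !mulr_sumr -big_split big_mkcond; apply: ler_sum => y _ /=.
case: ifP => [far|_]; last first.
  apply: addr_ge0; apply: mulr_ge0 => //; first exact: frob2_ge0.
  rewrite -f_dist mulr_ge0 ?sqn_ge0 //; apply: sumr_ge0 => p _; exact: sqr_ge0.
have -> : \sum_p \sum_q sqn (A (ix (p, x)) (ix (q, y))) = frob2 (blk x y).
  by apply: eq_bigr => p _; apply: eq_bigr => q _; rewrite mxE.
rewrite -{1}(subrK (y_ x y)%:M (blk x y)).
apply: le_trans (frob2D2_le _ _) _; rewrite lerD2l ler_wpM2l //.
rewrite frob2_scalar.
rewrite ler_wpM2r ?sqn_ge0 // -[leLHS]mulr1 [2 * _]mulrC -mulrA ler_wpM2l //.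
by have := theta_K far; lra.
Qed.

End FarMass.

End Model.

(** * Free group representations *)

Section Evaluation.
Variables (R : realType) (k d : nat) (M : 'I_k -> 'M[R[i]]_d).
Hypothesis uM : forall i, unitary (M i).

Definition lmx (x : letter k) : 'M[R[i]]_d := if x.2 then adjmx (M x.1) else M x.1.
Definition wmx (w : seq (letter k)) : 'M[R[i]]_d :=
  foldr (fun x A => lmx x *m A) 1%:M w.
Definition fgmx (g : FreeGroup k) : 'M[R[i]]_d := wmx (sval g).

Lemma unitary_lmx x : unitary (lmx x).
Proof. by rewrite /lmx; case: ifP => _ //; apply: unitary_adj. Qed.

Lemma lmx_linv x : lmx x *m lmx (linv x) = 1%:M.
Proof.
rewrite /lmx /linv /=; case: x.2 => /=; last exact: uM.
exact: unitaryV.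
Qed.

Lemma unitary_wmx w : unitary (wmx w).
Proof.
elim: w => [|x w IH] /=; first exact: unitary1.
by apply: unitaryM => //; apply: unitary_lmx.
Qed.

Lemma wmx_cat u v : wmx (u ++ v) = wmx u *m wmx v.
Proof. by elim: u => [|x u IH] /=; rewrite ?mul1mx // IH mulmxA. Qed.

Lemma wmx_red_cons x w : wmx (red_cons x w) = lmx x *m wmx w.
Proof.
case: w => [|y w] //=; case: eqP => [->|_] //.
by rewrite mulmxA lmx_linv mul1mx.
Qed.

Lemma wmx_reduce w : wmx (reduce w) = wmx w.
Proof. by elim: w => //= x w IH; rewrite wmx_red_cons IH. Qed.

Lemma fgmxM g h : fgmx (fg_mul g h) = fgmx g *m fgmx h.
Proof. by rewrite /fgmx /= wmx_reduce wmx_cat. Qed.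

Lemma unitary_fgmx g : unitary (fgmx g).
Proof. exact: unitary_wmx. Qed.

End Evaluation.

(** * Commutator estimates for words *)

Section Commutators.
Variables (R : realType) (d : nat).
Implicit Types A B C : 'M[R[i]]_d.

Definition comm2 A B : R := frob2 (A *m B - B *m A).

Lemma comm2C A B : comm2 A B = comm2 B A.
Proof. exact: frob2C. Qed.

Lemma comm2M A B C : unitary A -> unitary B ->
  comm2 (A *m B) C <= 2 * comm2 B C + 2 * comm2 A C.
Proof.
move=> uA uB; rewrite /comm2.
have -> : A *m B *m C - C *m (A *m B) =
    A *m (B *m C - C *m B) + (A *m C - C *m A) *m B.
  by rewrite mulmxBr mulmxBl !mulmxA addrA subrK.
apply: le_trans (frob2D2_le _ _) _.
by rewrite frob2_unitaryl // frob2_unitaryr.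
Qed.

Lemma comm2_adj A B : unitary A -> comm2 (adjmx A) B = comm2 A B.
Proof.
move=> uA; rewrite /comm2.
rewrite -(frob2_unitaryl _ uA) -(frob2_unitaryr _ uA) mulmxBr mulmxBl.
rewrite !mulmxA uA mul1mx -!mulmxA (unitaryV uA) mulmx1.
exact: frob2C.
Qed.

Lemma comm2_lmx k (M : 'I_k -> 'M[R[i]]_d) x B :
  (forall i, unitary (M i)) -> comm2 (lmx M x) B = comm2 (M x.1) B.
Proof. by move=> uM; rewrite /lmx; case: ifP => _ //; apply: comm2_adj. Qed.

(** The factor is crude, but it depends only on the word and not on the dimension. *)
Lemma comm2_wmx k (M : 'I_k -> 'M[R[i]]_d) w B (delta : R) :
  (forall i, unitary (M i)) -> 0 <= delta ->
  (forall i, comm2 (M i) B <= delta) ->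
  comm2 (wmx M w) B <= 4 ^+ size w * delta.
Proof.
move=> uM d0 h; elim: w => [|x w IH] /=.
  by rewrite /comm2 mul1mx mulmx1 subrr expr0 mul1r /frob2 big1 // => i _;
    rewrite big1 // => j _; rewrite mxE sqn0.
apply: le_trans (comm2M _ _ _) _; [exact: unitary_lmx|exact: unitary_wmx|].
rewrite comm2_lmx // exprS.
have := h x.1; have : 1 * delta <= 4 ^+ size w * delta.
  by rewrite ler_wpM2r // exprn_ege1 // ler1n.
by move: IH; lra.
Qed.

Lemma comm2_words k m (M : 'I_k -> 'M[R[i]]_d) (N : 'I_m -> 'M[R[i]]_d) u v
    (delta : R) :
  (forall i, unitary (M i)) -> (forall i, unitary (N i)) -> 0 <= delta ->
  (forall i j, comm2 (M i) (N j) <= delta) ->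
  comm2 (wmx M u) (wmx N v) <= 4 ^+ size u * (4 ^+ size v * delta).
Proof.
move=> uM uN d0 h; apply: comm2_wmx => // [|i].
  by rewrite mulr_ge0 // exprn_ge0.
rewrite comm2C; apply: comm2_wmx => // j; rewrite comm2C; exact: h.
Qed.

End Commutators.

(** * Normalised convergence in terms of squared norms *)

Section NormLimit.
Variables (R : realType) (d : nat -> nat) (A : forall n, 'M[R[i]]_(d n)).

Lemma hs_cvg0_frob2 : (forall n, (0 < d n)%N) ->
  seq_cvg (fun n => hs_norm (A n)) 0 ->
  forall eps : R, 0 < eps -> exists N : nat, forall n, (N <= n)%N ->
    frob2 (A n) <= eps * (d n)%:R.
Proof.
move=> d0 h eps e0; have [|N HN] := h (Num.sqrt eps).
  by rewrite sqrtr_gt0.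
exists N => n /HN; rewrite subr0 hs_norm_frob2 ger0_norm ?sqrtr_ge0 //.
rewrite ltr_sqrt // => /ltW.
by rewrite mulrC ler_pdivrMr // ltr0n.
Qed.

Lemma frob2_hs_cvg0 : (forall n, (0 < d n)%N) ->
  (forall eps : R, 0 < eps -> exists N : nat, forall n, (N <= n)%N ->
    frob2 (A n) <= eps * (d n)%:R) ->
  seq_cvg (fun n => hs_norm (A n)) 0.
Proof.
move=> d0 h eps e0; have e2 : 0 < (eps / 2) ^+ 2 by rewrite exprn_gt0 // divr_gt0.
have [N HN] := h _ e2; exists N => n /HN hn.
rewrite subr0 hs_norm_frob2 ger0_norm ?sqrtr_ge0 //.
apply: le_lt_trans (_ : Num.sqrt ((eps / 2) ^+ 2) < _); last first.
  by rewrite sqrtr_sqr ger0_norm; lra.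
by rewrite ler_wsqrtr // mulrC ler_pdivrMr // ltr0n.
Qed.

End NormLimit.

(** * Almost invariant means *)

From mathcomp Require Import boolp classical_sets.

(** A finitely supported dyadic probability measure on H, a leaf at depth n weighing 2^-n. Midpoints
    and translates of trees are trees, which is all that the convexity argument uses. *)
Inductive avg_tree (H : Type) :=
  | Leaf of H
  | Node of avg_tree H & avg_tree H.

Fixpoint tree_map (H H' : Type) (s : H -> H') (t : avg_tree H) : avg_tree H' :=
  match t with
  | Leaf h => Leaf (s h)
  | Node t1 t2 => Node (tree_map s t1) (tree_map s t2)
  end.

Section Average.
Variables (R : realType) (H : Type).
Implicit Types (F G : H -> R) (t : avg_tree H).

Fixpoint avg F t : R :=
  match t with
  | Leaf h => F h
  | Node t1 t2 => (avg F t1 + avg F t2) / 2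
  end.

Lemma avg_map F (s : H -> H) t : avg F (tree_map s t) = avg (fun h => F (s h)) t.
Proof. by elim: t => //= t1 -> t2 ->. Qed.

Lemma avg_le F G t : (forall h, F h <= G h) -> avg F t <= avg G t.
Proof. by move=> FG; elim: t => //= t1 h1 t2 h2; lra. Qed.

Lemma eq_avg F G t : F =1 G -> avg F t = avg G t.
Proof. by move=> FG; elim: t => //= t1 -> t2 ->. Qed.

Lemma avg_cst (a : R) t : avg (fun=> a) t = a.
Proof. by elim: t => //= t1 -> t2 ->; lra. Qed.

Lemma avgD F G t : avg (fun h => F h + G h) t = avg F t + avg G t.
Proof. by elim: t => //= t1 -> t2 ->; lra. Qed.

Lemma avgZ (a : R) F t : avg (fun h => a * F h) t = a * avg F t.
Proof. by elim: t => //= t1 -> t2 ->; lra. Qed.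

Lemma avg_sum (I : finType) (P : pred I) (F : I -> H -> R) t :
  avg (fun h => \sum_(i | P i) F i h) t = \sum_(i | P i) avg (F i) t.
Proof.
elim: t => //= t1 -> t2 ->; rewrite -big_split /= mulr_suml.
by apply: eq_bigr => i _.
Qed.

End Average.

Section AlmostInvariantMean.
Variables (R : realType) (D : nat) (H : Type) (uu : H -> 'M[R[i]]_D).
Variables (S : Type) (G : S -> 'M[R[i]]_D) (ga : S -> H -> H) (h0 : H).
Hypothesis uG : forall s, unitary (G s).
Hypothesis uuG : forall s h, uu (ga s h) = G s *m uu h.

(** The averaged squared entries are the diagonal entries of this average of rank one projections.
    In matrix form, translation becomes conjugation by a unitary, an isometry of a Hilbert space. *)
Fixpoint proj_avg (j : 'I_D) (t : avg_tree H) : 'M[R[i]]_D :=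
  match t with
  | Leaf h => uu h *m delta_mx j j *m adjmx (uu h)
  | Node t1 t2 => (2^-1)%:C%C *: (proj_avg j t1 + proj_avg j t2)
  end.

Lemma proj_avg_map s j t :
  proj_avg j (tree_map (ga s) t) = G s *m proj_avg j t *m adjmx (G s).
Proof.
elim: t => [h|t1 h1 t2 h2] /=; first by rewrite uuG adjmxM !mulmxA.
by rewrite h1 h2 -scalemxAr -scalemxAl mulmxDr mulmxDl.
Qed.

Lemma Re_proj_avg i j t :
  complex.Re (proj_avg j t i i) = avg (fun h => sqn (uu h i j)) t.
Proof.
elim: t => [h|t1 h1 t2 h2] /=.
  rewrite mxE (bigD1 j) //= big1 ?addr0 => [|l lj]; last first.
    rewrite mxE big1 ?mul0r // => r _; rewrite mxE.
    by rewrite (negbTE lj) andbF mulr0.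
  rewrite [adjmx _ _ _]mxE [_^T _ _]mxE mxE (bigD1 j) //= big1 ?addr0.
    by rewrite mxE !eqxx mulr1 -sqnE.
  by move=> r rj; rewrite mxE (negbTE rj) mulr0.
rewrite 2!mxE -h1 -h2.
by case: (proj_avg j t1 i i) (proj_avg j t2 i i) => a b [c e] /=; ring.
Qed.

Definition energy t : R := \sum_j frob2 (proj_avg j t).

Lemma energy_ge0 t : 0 <= energy t.
Proof. by apply: sumr_ge0 => j _; exact: frob2_ge0. Qed.

Lemma frob2Z (a : R) m n (A : 'M[R[i]]_(m, n)) :
  frob2 (a%:C%C *: A) = a ^+ 2 * frob2 A.
Proof.
rewrite /frob2 mulr_sumr; apply: eq_bigr => i _.
by rewrite mulr_sumr; apply: eq_bigr => j _; rewrite mxE sqnM sqn_real.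
Qed.

Lemma energy_midpoint s t : \sum_j frob2 (proj_avg j t - proj_avg j (tree_map (ga s) t))
  = 4 * (energy t - energy (Node t (tree_map (ga s) t))).
Proof.
rewrite /energy -sumrB mulr_sumr; apply: eq_bigr => j _ /=.
rewrite frob2Z; have := frob2_parallelogram (proj_avg j t)
  (proj_avg j (tree_map (ga s) t)).
have -> : frob2 (proj_avg j (tree_map (ga s) t)) = frob2 (proj_avg j t).
  by rewrite proj_avg_map frob2_unitaryr ?frob2_unitaryl //; apply: unitary_adj.
by move: (frob2 _) (frob2 _) (frob2 _) => a b c; lra.
Qed.

(* A tree whose energy is within eta^2/4 of the infimum: by the parallelogram
   identity its translates have nearly the same average. *)
Lemma almost_invariant_mean (eta : R) : 0 < eta -> exists t, forall s i j,
  avg (fun h => sqn (uu (ga s h) i j)) t <=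
  avg (fun h => sqn (uu h i j)) t + eta.
Proof.
move=> e0; pose Es := [set energy t | t in [set: avg_tree H]]%classic.
have lb : lbound Es 0 by move=> _ [t _ <-]; exact: energy_ge0.
have hinf : has_inf Es.
  by split; [exists (energy (Leaf h0)), (Leaf h0) | exists 0].
have e2 : 0 < eta ^+ 2 / 4 by rewrite divr_gt0 // exprn_gt0.
have [_ [t _ <-] ht] := inf_adherent e2 hinf.
exists t => s i j.
(* The midpoint of [t] and its translate is again a tree, so its energy cannot fall below the
   infimum. *)
have hn : inf Es <= energy (Node t (tree_map (ga s) t)).
  by apply: ge_inf; [exists 0 | exists (Node t (tree_map (ga s) t))].
have hs := energy_midpoint s t.
have hj : frob2 (proj_avg j t - proj_avg j (tree_map (ga s) t)) <= eta ^+ 2.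
  apply: le_trans (_ : _ <= \sum_j frob2 (proj_avg j t -
    proj_avg j (tree_map (ga s) t))) _; last by rewrite hs; lra.
  rewrite (bigD1 j) //= lerDl; apply: sumr_ge0 => l _; exact: frob2_ge0.
rewrite -(avg_map (fun h => sqn (uu h i j))) -!Re_proj_avg.
have := le_trans (frob2_entry _ i i) hj; rewrite 2!mxE.
move=> /(le_trans (sqn_ge_Re _)).
case: (proj_avg j t i i) (proj_avg j _ i i) => a b [c e] /= hac.
by case: (lerP c (a + eta)) => // h; nra.
Qed.

End AlmostInvariantMean.

(** * The paradoxical decomposition *)

Section Dilation.
Variables (R : realType) (d e : nat).
Implicit Types (A B : 'M[R[i]]_d) (P Q : 'M[R[i]]_(d + e)).

(** Extending by the identity keeps unitaries unitary and lets the model matrices be compared with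
    the representation on the larger space. *)
Definition dilate A : 'M[R[i]]_(d + e) := block_mx A 0 0 1%:M.

Lemma ulsubmxB P Q : ulsubmx (P - Q) = ulsubmx P - ulsubmx Q.
Proof. by apply/matrixP => i j; rewrite !mxE. Qed.

Lemma ulsubmx_mul_dilate P A : ulsubmx (P *m dilate A) = ulsubmx P *m A.
Proof.
rewrite -{1}(submxK P) mulmx_block block_mxKul.
by rewrite mulmx0 addr0.
Qed.

Lemma ulsubmx_dilate_mul A P : ulsubmx (dilate A *m P) = A *m ulsubmx P.
Proof.
rewrite -{1}(submxK P) mulmx_block block_mxKul.
by rewrite mul0mx addr0.
Qed.

Lemma frob2_usubmx P : unitary P ->
  frob2 (ulsubmx P) + frob2 (ursubmx P) = d%:R.
Proof.
move=> uP; rewrite /frob2 -big_split /=.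
rewrite (eq_bigr (fun=> 1)) ?sumr_const ?card_ord // => i _.
rewrite -(unitary_row (lshift e i) uP) big_split_ord /=.
by congr (_ + _); apply: eq_bigr => j _; rewrite !mxE.
Qed.

Lemma frob2_lsubmx P : unitary P ->
  frob2 (ulsubmx P) + frob2 (dlsubmx P) = d%:R.
Proof.
move=> uP; rewrite /frob2 (exchange_big_dep xpredT) //=.
rewrite [X in _ + X](exchange_big_dep xpredT) //= -big_split /=.
rewrite (eq_bigr (fun=> 1)) ?sumr_const ?card_ord // => i _.
rewrite -(unitary_col (lshift e i) uP) big_split_ord /=.
by congr (_ + _); apply: eq_bigr => j _; rewrite !mxE.
Qed.

Lemma frob2_dsubmx P : unitary P ->
  frob2 (dlsubmx P) + frob2 (drsubmx P) = e%:R.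
Proof.
move=> uP; have := frob2_usubmx uP; have := frob2_block P.
by rewrite (frob2_unitary uP) natrD; lra.
Qed.

Lemma frob2_ulsubmx_ge P : unitary P -> d%:R - e%:R <= frob2 (ulsubmx P).
Proof.
move=> uP; have := frob2_lsubmx uP; have := frob2_dsubmx uP.
by have := frob2_ge0 (drsubmx P); lra.
Qed.

Lemma frob2_ulsubmx_unitary_le P : unitary P -> frob2 (ulsubmx P) <= d%:R.
Proof.
by move=> uP; have := frob2_lsubmx uP; have := frob2_ge0 (dlsubmx P); lra.
Qed.

(** The corner of [P] is close to a unitary and so carries nearly the whole mass of its rows and
    columns; this leaves little for the off-diagonal blocks, and the last block is small because [e]
    is. *)
Lemma frob2_ext_le (kappa : R) A P : 0 < kappa <= 1 -> unitary A -> unitary P ->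
  frob2 (A - ulsubmx P) <= kappa ^+ 2 * d%:R -> e%:R <= kappa * d%:R ->
  frob2 (P - dilate A) <= 12 * kappa * d%:R.
Proof.
move=> /andP[k0 k1] uA uP hA he.
have hd : 0 <= d%:R :> R by rewrite ler0n.
have -> : P - dilate A =
    block_mx (ulsubmx P - A) (ursubmx P) (dlsubmx P) (drsubmx P - 1%:M).
  by rewrite -{1}(submxK P) /dilate opp_block_mx add_block_mx !oppr0 !addr0.
rewrite frob2_block block_mxKul block_mxKur block_mxKdl block_mxKdr.
rewrite frob2C.
(* Young's inequality with weight kappa turns the error kappa^2 into O(kappa). In units of kappa d
   the four blocks cost at most 1, 3, 3 and 4. *)
have h1 := frob2B_le A (ulsubmx P) k0; rewrite (frob2_unitary uA) in h1.
have h2 := frob2_usubmx uP; have h3 := frob2_lsubmx uP.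
have h4 := frob2_dsubmx uP; have h5 := frob2_ge0 (dlsubmx P).
have h6 := frob2B2_le (drsubmx P) 1%:M.
have h7 : frob2 (1%:M : 'M[R[i]]_e) = e%:R.
  by rewrite frob2_scalar sqn1 mulr1.
have h8 : (1 + kappa^-1) * frob2 (A - ulsubmx P) <= (kappa ^+ 2 + kappa) * d%:R.
  apply: le_trans (_ : (1 + kappa^-1) * (kappa ^+ 2 * d%:R) <= _).
    by rewrite ler_wpM2l // addr_ge0 // invr_ge0 ltW.
  rewrite le_eqVlt; apply/orP; left; apply/eqP; field.
  by rewrite gt_eqF.
have h9 := frob2_ulsubmx_unitary_le uP.
have h10 := frob2_ge0 (ulsubmx P).
move: h1 h2 h3 h4 h5 h6 h7 h8 h9 h10 hA he hd.
move: (frob2 (ulsubmx P)) (frob2 (ursubmx P)) (frob2 (dlsubmx P))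
  (frob2 (drsubmx P)) (frob2 (drsubmx P - 1%:M)) (frob2 (1%:M : 'M_e))
  ((1 + kappa^-1) * frob2 (A - ulsubmx P)) (frob2 (A - ulsubmx P))
  (d%:R : R) (e%:R : R) => a b c f g h p q dd ee.
move=> h1 h2 h3 h4 h5 h6 h7 h8 h9 h10 hA he hd.
have k2 : kappa ^+ 2 * dd <= kappa * dd.
  by rewrite ler_wpM2r // expr2 -[leRHS]mulr1 ler_wpM2l // ltW.
have ka : kappa * a <= kappa * dd by rewrite ler_wpM2l // ltW.
rewrite !mulrDl !mul1r in h1 h8.
have -> : 12 * kappa * dd = 12 * (kappa * dd) by ring.
by lra.
Qed.

End Dilation.

(** * Almost invariant mass against the disjoint sets W_i *)

Section Contradiction.
Variables (R : realType) (X E : finType) (c : X -> E -> bool) (m' : nat).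
Notation m := m'.+1.
Variables (f : 'I_m -> X -> R) (theta : R).
Hypothesis m_odd : odd m.
Hypothesis f_sqr : forall p x, f p x ^+ 2 = 1.
Hypothesis f_corr : forall x y,
  \sum_p f p x * f p y = m%:R * theta ^+ ham (c x) (c y).
Variable K : nat.
Hypothesis theta_K : forall h, (K <= h)%N -> theta ^+ h <= 1 / 2.
Variables (mv : colour -> X -> X) (W : colour -> X -> X -> bool).
Hypothesis mv_inv : forall i, involutive (mv i).
Hypothesis W_uniq : forall i j x y, W i x y -> W j x y -> i = j.
Hypothesis W_paradox : forall i j x y, i != j -> (ham (c x) (c y) <= K)%N ->
  ~~ W j x y -> W i (mv i (mv j x)) y.

Notation dim := #|{: site X m'}|.
Hypothesis dim_gt0 : (0 < dim)%N.
Variables (e : nat) (kappa : R).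
Hypothesis kappa_gt0 : 0 < kappa.
Hypothesis kappa_small : kappa * (1000 * 1000 * 1000) <= 1.
Hypothesis e_small : e%:R <= kappa * dim%:R.

Variables (H : Type) (uu : H -> 'M[R[i]]_(dim + e)) (h0 : H).
Variables (P1 P2 : 'M[R[i]]_(dim + e)).
Hypothesis uuu : forall h, unitary (uu h).
Hypothesis comm1P : forall h, uu h *m P1 = P1 *m uu h.
Hypothesis comm2P : forall h, uu h *m P2 = P2 *m uu h.
Hypothesis near1 : frob2 (P1 - dilate e (U1 f)) <= 12 * kappa * dim%:R.
Hypothesis near2 : frob2 (P2 - dilate e (U2 R X m')) <= 12 * kappa * dim%:R.

(** All three pairs of colours occur; the third product is x_1 x_2 = (x_0 x_1)^-1 (x_0 x_2), still
    in the group generated by the other two. *)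
Definition colour_pair (s : 'I_3) : colour * colour :=
  match val s with
  | 0 => (inord 0, inord 1) | 1 => (inord 0, inord 2) | _ => (inord 1, inord 2)
  end%N.
Definition gmap (s : 'I_3) (x : X) : X := mv (colour_pair s).1 (mv (colour_pair s).2 x).

Variables (G : 'I_3 -> 'M[R[i]]_(dim + e)) (ga : 'I_3 -> H -> H).
Hypothesis uG : forall s, unitary (G s).
Hypothesis uuG : forall s h, uu (ga s h) = G s *m uu h.
Hypothesis nearG : forall s,
  frob2 (G s - dilate e (Vp R m' (gmap s))) <= 12 * kappa * dim%:R.

Lemma gmap_inj s : injective (gmap s).
Proof. by move=> x y /(inv_inj (mv_inv _)) /(inv_inj (mv_inv _)). Qed.

Lemma kd_small : (kappa * dim%:R) * (1000 * 1000 * 1000) <= dim%:R.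
Proof.
rewrite mulrAC -[leRHS]mul1r ler_wpM2r //; exact: ler0n.
Qed.

Let xx h := ulsubmx (uu h).
(** A measure on X * X whose total mass lies between dim - e and dim. *)
Let mu h x y : R := \sum_p \sum_q sqn (xx h (ix (p, x)) (ix (q, y))).

Lemma mu_ge0 h x y : 0 <= mu h x y.
Proof. by apply: sumr_ge0 => p _; apply: sumr_ge0 => q _; exact: sqn_ge0. Qed.

Lemma mu_total h : \sum_x \sum_y mu h x y = frob2 (xx h).
Proof. by rewrite frob2_blocks. Qed.

Lemma corner_comm (P : 'M[R[i]]_(dim + e)) (A : 'M[R[i]]_dim) h :
  uu h *m P = P *m uu h ->
  frob2 (P - dilate e A) <= 12 * kappa * dim%:R ->
  frob2 (xx h *m A - A *m xx h) <= 48 * kappa * dim%:R.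
Proof.
move=> cP nP; rewrite /xx -ulsubmx_mul_dilate -ulsubmx_dilate_mul -ulsubmxB.
apply: le_trans (frob2_ulsubmx_le _) _.
have -> : uu h *m dilate e A - dilate e A *m uu h =
    (P - dilate e A) *m uu h - uu h *m (P - dilate e A).
  by rewrite mulmxBl mulmxBr cP opprB [RHS]addrC addrA subrK.
apply: le_trans (frob2B2_le _ _) _.
rewrite frob2_unitaryr // frob2_unitaryl //.
by move: nP; rewrite -!mulrA; lra.
Qed.

(** Exact commutation with [P1] and [P2] makes the corner almost commute with [U1] and [U2], so
    [far_mass] applies; the size of [kappa] absorbs its constant. *)
Lemma mu_far h :
  \sum_x \sum_(y | (K <= ham (c x) (c y))%N) mu h x y <= dim%:R / 40.
Proof.
have d0 : 0 < dim%:R :> R by rewrite ltr0n.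
have h1 := corner_comm (comm1P h) near1; have h2 := corner_comm (comm2P h) near2.
apply: le_trans (far_mass m_odd f_sqr f_corr (xx h) theta_K) _.
have := kd_small; move: h1 h2; rewrite -!(mulrA _ kappa).
by move: (frob2 _) (frob2 _) => a b; lra.
Qed.

Let muW h i : R := \sum_x \sum_(y | W i x y) mu h x y.

Lemma muW_sum h : \sum_i muW h i <= dim%:R.
Proof.
apply: le_trans (_ : _ <= \sum_x \sum_y mu h x y) _; last first.
  by rewrite mu_total; apply: frob2_ulsubmx_unitary_le.
rewrite exchange_big /=; apply: ler_sum => x _.
rewrite (exchange_big_dep xpredT) //=; apply: ler_sum => y _.
case: (pickP (fun i => W i x y)) => [i wi|w0]; last first.
  by rewrite big_pred0 ?mu_ge0.
rewrite (big_pred1 i) // => j /=; apply/idP/eqP => [wj|-> //].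
exact: W_uniq wj wi.
Qed.

Lemma mu_near_cover h j : dim%:R * (19 / 20) <=
  muW h j + \sum_x \sum_(y | (ham (c x) (c y) <= K)%N && ~~ W j x y) mu h x y.
Proof.
have d0 : 0 < dim%:R :> R by rewrite ltr0n.
have ft := frob2_ulsubmx_ge (uuu h); have hf := mu_far h.
have : frob2 (xx h) <= muW h j +
  \sum_x \sum_(y | (ham (c x) (c y) <= K)%N && ~~ W j x y) mu h x y +
  \sum_x \sum_(y | (K <= ham (c x) (c y))%N) mu h x y.
  rewrite -mu_total /muW -!big_split /=; apply: ler_sum => x _.
  rewrite (big_mkcond (W j x)) (big_mkcond (fun y => (K <= _)%N)) /=.
  rewrite [X in _ + X + _]big_mkcond -!big_split /=.
  apply: ler_sum => y _; have := mu_ge0 h x y.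
  (* Pairs at distance exactly K count both as near and as far, which is harmless in an upper
     bound. *)
  case: (leqP K (ham (c x) (c y))) => [_|/ltnW ->]; last first.
    by case: (W j x y) => /=; lra.
  by case: (W j x y); case: (leqP _ K) => _ /=; lra.
have := kd_small; have : 0 <= kappa * dim%:R by rewrite mulr_ge0 // ltW.
by move: e_small ft hf; rewrite -/(xx h); lra.
Qed.

(** Left multiplication by [G s] almost moves the first coordinate by [gmap s], and the paradox
    sends every near pair outside the second set into the first. The factor 9/8 is 1 + s in Young's
    inequality. *)
Lemma mu_shift h s : \sum_x \sum_(y | (ham (c x) (c y) <= K)%N &&
      ~~ W (colour_pair s).2 x y) mu h x y
  <= 9 / 8 * muW (ga s h) (colour_pair s).1 + dim%:R / 40.
Proof.
have d0 : 0 < dim%:R :> R by rewrite ltr0n.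
have s0 : 0 < 8^-1 :> R by lra.
pose V := Vp R m' (gmap s); pose dif := V *m xx h - xx (ga s h).
have hd : frob2 dif <= 12 * kappa * dim%:R.
  rewrite /dif /xx -ulsubmx_dilate_mul -ulsubmxB uuG -mulmxBl.
  apply: le_trans (frob2_ulsubmx_le _) _; rewrite frob2_unitaryr // frob2C.
  exact: nearG.
have gi := @gmap_inj s.
pose D x y := \sum_p \sum_q sqn (dif (ix (p, gmap s x)) (ix (q, y))).
have D0 x y : 0 <= D x y.
  by apply: sumr_ge0 => p _; apply: sumr_ge0 => q _; exact: sqn_ge0.
have hD : \sum_x \sum_y D x y = frob2 dif.
  by rewrite frob2_blocks [RHS](reindex_inj gi).
have step x y : mu h x y <= (1 + 8^-1) * mu (ga s h) (gmap s x) y + (1 + 8) * D x y.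
  rewrite /mu /D !mulr_sumr -big_split; apply: ler_sum => p _ /=.
  rewrite !mulr_sumr -big_split; apply: ler_sum => q _ /=.
  rewrite -(@mulVp _ _ _ (gmap s) _ (p, x)) //=.
  have := sqnB_le ((V *m xx h) (ix (p, gmap s x)) (ix (q, y)))
    (xx (ga s h) (ix (p, gmap s x)) (ix (q, y))) s0.
  by rewrite invrK /dif mxBE.
apply: le_trans (_ : _ <= \sum_x \sum_(y | W (colour_pair s).1 (gmap s x) y)
   ((1 + 8^-1) * mu (ga s h) (gmap s x) y) + (1 + 8) * \sum_x \sum_y D x y) _.
  rewrite mulr_sumr -big_split; apply: ler_sum => x _ /=.
  rewrite big_mkcond [X in _ <= X + _]big_mkcond mulr_sumr -big_split.
  apply: ler_sum => y _ /=; case: ifP => [/andP[hK nW]|_].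
    rewrite W_paradox ?step // /colour_pair.
    by case: s {V dif hd gi D D0 hD step nW} => -[|[|[|//]]] ? /=;
      rewrite -val_eqE /= !inordK.
  apply: addr_ge0; last by apply: mulr_ge0; [lra | exact: D0].
  by case: ifP => // _; apply: mulr_ge0; [lra | exact: mu_ge0].
rewrite hD; have -> : \sum_x \sum_(y | W (colour_pair s).1 (gmap s x) y)
   (1 + 8^-1) * mu (ga s h) (gmap s x) y = 9 / 8 * muW (ga s h) (colour_pair s).1.
  rewrite /muW [in RHS](reindex_inj gi) mulr_sumr; apply: eq_bigr => x _.
  by rewrite mulr_sumr; apply: eq_bigr => y _; congr (_ * _); lra.
rewrite lerD2l.
by have := kd_small; move: hd; rewrite -!(mulrA _ kappa); lra.
Qed.

Theorem paradox : False.
Proof.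
have d0 : 0 < dim%:R :> R by rewrite ltr0n.
(* The error is incurred once per matrix entry; over dim^2 entries it sums to dim/40. *)
have eta0 : 0 < (40 * dim%:R)^-1 :> R by rewrite invr_gt0 mulr_gt0.
have [t ht] := almost_invariant_mean h0 uG uuG eta0.
have tot0 : \sum_(x : X) \sum_(y : X) \sum_(p < m) \sum_(q < m) (40 * dim%:R)^-1
    = dim%:R / 40 :> R.
  rewrite !sumr_const !card_ord -!mulrnA.
  have -> : (m * (m * (#|X| * #|X|)))%N = (dim * dim)%N.
    by rewrite card_prod card_ord; lia.
  by rewrite -[LHS]mulr_natr natrM; field; rewrite gt_eqF.
pose M i := avg (muW^~ i) t.
have Msh s i : avg (fun h => muW (ga s h) i) t <= M i + dim%:R / 40.
  rewrite /M /muW !avg_sum.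
  apply: le_trans (_ : _ <= \sum_x (avg (fun h => \sum_(y | W i x y) mu h x y) t
    + \sum_(y : X) \sum_(p < m) \sum_(q < m) (40 * dim%:R)^-1)) _.
    apply: ler_sum => x _; rewrite !avg_sum [X in _ <= _ + X](bigID (W i x)) /=.
    rewrite addrA -[leLHS]addr0; apply: lerD; last first.
      by do 3!(apply: sumr_ge0 => ? _); rewrite ltW.
    rewrite -big_split; apply: ler_sum => y _ /=; rewrite /mu !avg_sum -big_split.
    apply: ler_sum => p _ /=; rewrite !avg_sum -big_split.
    apply: ler_sum => q _ /=; rewrite /xx.
    have := ht s (lshift e (ix (p, x))) (lshift e (ix (q, y))).
    set F1 := fun h => sqn (uu (ga s h) _ _); set F2 := fun h => sqn (uu h _ _).
    move=> hF.
    rewrite (@eq_avg _ _ _ F1); last by move=> h; rewrite !mxE.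
    by rewrite [X in _ <= X + _](@eq_avg _ _ _ F2) // => h; rewrite !mxE.
  by rewrite big_split /= lerD2l tot0.
have key s : dim%:R * (19 / 20) <=
    M (colour_pair s).2 + (9 / 8 * (M (colour_pair s).1 + dim%:R / 40) + dim%:R / 40).
  rewrite -(avg_cst (dim%:R * (19 / 20)) t).
  apply: le_trans (_ : _ <= avg (fun h => muW h (colour_pair s).2 +
     (9 / 8 * muW (ga s h) (colour_pair s).1 + dim%:R / 40)) t) _.
    apply: avg_le => h; apply: le_trans (mu_near_cover h (colour_pair s).2) _.
    by rewrite lerD2l mu_shift.
  rewrite !avgD avgZ avg_cst lerD2l lerD2r ler_wpM2l ?Msh //; lra.
have tot : M (inord 0) + M (inord 1) + M (inord 2) <= dim%:R.
  rewrite -(avg_cst dim%:R t).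
  apply: le_trans (avg_le t muW_sum); rewrite avg_sum.
  rewrite !big_ord_recl big_ord0 addr0 addrA le_eqVlt; apply/orP; left; apply/eqP.
  by congr (_ + _ + _); apply: eq_avg => h; congr (muW h _);
    apply/val_inj; rewrite /= inordK.
have M0 i : 0 <= M i.
  rewrite -(avg_cst 0 t); apply: avg_le => h; apply: sumr_ge0 => x _.
  by apply: sumr_ge0 => y _; exact: mu_ge0.
(* Adding the three instances of [key] bounds 3 (19/20) dim by at most 9/4 of the total mass plus 3
   (17/320) dim, which is impossible because the total is at most dim. *)
have := key (inord 0); have := key (inord 1); have := key (inord 2).
rewrite /colour_pair /= !inordK //=; have := M0 (inord 0); have := M0 (inord 1).
by have := M0 (inord 2); lra.
Qed.

End Contradiction.

(** * The theorem *)

Section Bernoulli.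
Variable R : realType.

Lemma bernoulli_ge (x : R) n : 0 <= x -> 1 + n%:R * x <= (1 + x) ^+ n.
Proof.
move=> x0; elim: n => [|n IH]; first by rewrite mul0r addr0 expr0.
rewrite exprS -natr1; have n0 : 0 <= n%:R * x * x by rewrite !mulr_ge0.
have : (1 + x) * (1 + n%:R * x) <= (1 + x) * (1 + x) ^+ n.
  by rewrite ler_wpM2l // addr_ge0.
by apply: le_trans; lra.
Qed.

Lemma bernoulli_le (t : R) n : 0 <= t <= 1 -> 1 - t ^+ n <= n%:R * (1 - t).
Proof.
case/andP=> t0 t1; elim: n => [|n IH]; first by rewrite expr0 subrr mul0r.
rewrite exprS -natr1; have h : t ^+ n <= 1 by rewrite exprn_ile1.
have : (1 - t) * t ^+ n <= (1 - t) * 1 by rewrite ler_wpM2l // subr_ge0.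
by lra.
Qed.

(** Bernoulli's inequality is applied to the inverse 1 + 2/(b - 2). *)
Lemma theta_half (b h : nat) : (2 < b)%N -> (b <= h)%N ->
  (1 - 2 / b%:R : R) ^+ h <= 1 / 2.
Proof.
move=> b2 bh; have b0 : 2 < b%:R :> R by rewrite ltr_nat.
have bn : b%:R != 0 :> R by rewrite gt_eqF //; lra.
have t0 : 0 < 1 - 2 / b%:R :> R.
  by rewrite subr_gt0 ltr_pdivrMr ?mul1r //; lra.
have t1 : 1 - 2 / b%:R <= 1 :> R.
  by rewrite lerBlDr lerDl divr_ge0 //; lra.
apply: le_trans (_ : (1 - 2 / b%:R) ^+ b <= _).
  by apply: ler_wiXn2l => //; exact: ltW.
have x0 : 0 <= 2 / (b%:R - 2) :> R by rewrite divr_ge0 // subr_ge0 ltW.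
have := bernoulli_ge b x0.
have -> : 1 + 2 / (b%:R - 2) = (1 - 2 / b%:R)^-1 :> R.
  by field; rewrite bn; apply/andP; split => //; rewrite gt_eqF //; lra.
rewrite exprVn => hb.
have h2 : 2 <= ((1 - 2 / b%:R) ^+ b)^-1 :> R.
  apply: le_trans hb; rewrite -lerBlDl mulrA ler_pdivlMr; lra.
by rewrite div1r -[leLHS]invrK lef_pV2 ?posrE ?invr_gt0 ?exprn_gt0.
Qed.

End Bernoulli.

Definition fg_one k : FreeGroup k := exist _ [::] isT.
Definition fgen k (i : 'I_k) : FreeGroup k := exist _ [:: (i, false)] isT.
Definition fgenV k (i : 'I_k) : FreeGroup k := exist _ [:: (i, true)] isT.

Lemma fg_mul11 k : fg_mul (fg_one k) (fg_one k) = fg_one k.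
Proof. exact: val_inj. Qed.

Lemma fg_mul_comm1 k (g : FreeGroup k) : fg_mul g (fg_one k) = fg_mul (fg_one k) g.
Proof. by apply: val_inj; rewrite /= cats0. Qed.

Section ProductRep.
Variables (R : realType) (k m d : nat).
Variables (M : 'I_k -> 'M[R[i]]_d) (N : 'I_m -> 'M[R[i]]_d).
Hypotheses (uM : forall i, unitary (M i)) (uN : forall i, unitary (N i)).

Definition prep (z : FkFm k m) : 'M[R[i]]_d := fgmx M z.1 *m fgmx N z.2.

Lemma unitary_prep z : unitary (prep z).
Proof. by apply: unitaryM; apply: unitary_fgmx. Qed.

(** Each factor is an exact representation, so the only defect comes from moving the word of [z.1]
    past that of [y.2]. *)
Lemma prep_defect (delta : R) y z : 0 <= delta ->
  (forall i j, comm2 (M i) (N j) <= delta) ->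
  frob2 (prep (prod_mul y z) - prep y *m prep z) <=
  4 ^+ size (sval z.1) * (4 ^+ size (sval y.2) * delta).
Proof.
move=> d0 h; rewrite /prep /prod_mul /= !fgmxM //.
have -> : fgmx M y.1 *m fgmx M z.1 *m (fgmx N y.2 *m fgmx N z.2) -
    fgmx M y.1 *m fgmx N y.2 *m (fgmx M z.1 *m fgmx N z.2) =
    fgmx M y.1 *m ((fgmx M z.1 *m fgmx N y.2 - fgmx N y.2 *m fgmx M z.1)
      *m fgmx N z.2).
  by rewrite mulmxBl mulmxBr !mulmxA.
rewrite frob2_unitaryl ?frob2_unitaryr; try exact: unitary_fgmx.
exact: comm2_words.
Qed.

End ProductRep.

(** The finitely many elements at which closeness is used: two generators on each side, and the word
    giving the third pair of colours. *)
Definition test_elt k m (i0 i1 : 'I_k) (j0 j1 : 'I_m) (t : 'I_5) : FkFm k m :=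
  match val t with
  | 0 => (fgen i0, fg_one m)
  | 1 => (fgen i1, fg_one m)
  | 2 => (fg_one k, fgen j0)
  | 3 => (fg_one k, fgen j1)
  | _ => (fg_one k, fg_mul (fgenV j0) (fgen j1))
  end%N.

Lemma frob20 (R : realType) m n : frob2 (0 : 'M[R[i]]_(m, n)) = 0.
Proof. by rewrite /frob2 big1 // => i _; rewrite big1 // => j _; rewrite mxE sqn0. Qed.

(** The commutator bound tends to 0 with n, while the tolerance [kappa] for a nearby representation
    stays fixed. *)
Definition obstructing (R : realType) (k m n : nat) (i0 i1 : 'I_k) (j0 j1 : 'I_m)
    (kappa : R) (d : nat) (M : 'I_k -> 'M[R[i]]_d) (N : 'I_m -> 'M[R[i]]_d) : Prop :=
  [/\ (0 < d)%N, forall i, unitary (M i), forall j, unitary (N j),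
      forall i j, comm2 (M i) (N j) <= 16 / (2 * n + 3)%:R * d%:R &
      forall e (rho : FkFm k m -> 'M[R[i]]_(d + e)),
        is_unitary_rep (@prod_mul k m) rho -> e%:R <= kappa * d%:R ->
        (forall t, let z := test_elt i0 i1 j0 j1 t in
          frob2 (prep M N z - ulsubmx (rho z)) <= kappa ^+ 2 * d%:R) -> False].

Lemma exists_obstructing (R : realType) (k m n : nat) (i0 i1 : 'I_k)
    (j0 j1 : 'I_m) (kappa : R) : i0 != i1 -> j0 != j1 ->
  0 < kappa -> kappa * (1000 * 1000 * 1000) <= 1 ->
  exists z : {d : nat & (('I_k -> 'M[R[i]]_d) * ('I_m -> 'M[R[i]]_d))%type},
    obstructing n i0 i1 j0 j1 kappa (projT2 z).1 (projT2 z).2.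
Proof.
(* The odd number b = 2n + 3 serves both as the parameter of the random signs and as the distance K
   beyond which pairs are far. *)
move=> i01 j01 kappa0 kappa1; pose b' := (2 * n + 2)%N; pose b := b'.+1.
have b2 : (2 < b)%N by rewrite /b /b'; lia.
have eb : (2 * n + 3)%N = b by rewrite /b /b'; lia.
have b0 : 0 < b%:R :> R by rewrite ltr0n.
have [X [x0 [mv [E [c [W [mv_inv mv_ham W_uniq W_par]]]]]]] := tree_like_space b.
have b'0 : (0 < b')%N by rewrite /b'; lia.
have bodd : odd b by rewrite /b /b'; lia.
have [m' [f [m_odd f_sqr f_corr]]] := sign_family R c b'0 bodd.
pose d := #|{: site X m'}|.
have d0 : (0 < d)%N by apply/card_gt0P; exists (ord0, x0).
pose g (i j : nat) : X -> X := mv (inord i) \o mv (inord j).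
have gi i j : injective (g i j) by apply: inj_comp; exact: inv_inj.
pose M i : 'M[R[i]]_d :=
  if i == i0 then U1 f else if i == i1 then U2 R X m' else 1%:M.
pose N j : 'M[R[i]]_d := if j == j0 then Vp R m' (g 0 1)%N else
  if j == j1 then Vp R m' (g 0 2)%N else 1%:M.
have uM i : unitary (M i).
  rewrite /M; case: ifP => _; first exact: unitary_U1.
  by case: ifP => _; [exact: unitary_U2 | exact: unitary1].
have uN j : unitary (N j).
  rewrite /N; case: ifP => _; first exact: unitary_Vp.
  by case: ifP => _; [exact: unitary_Vp | exact: unitary1].
exists (existT _ d (M, N)); split=> //=.
  have r0 : 0 <= 16 / (2 * n + 3)%:R * d%:R :> R by rewrite mulr_ge0 ?divr_ge0.
  have cV i p q : comm2 (M i) (Vp R m' (g p q)) <= 16 / (2 * n + 3)%:R * d%:R.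
    rewrite /M; case: ifP => _; last first.
      case: ifP => _; rewrite /comm2 ?mul1mx ?mulmx1; last by rewrite subrr frob20.
      by rewrite commU2 // subrr frob20.
    rewrite /comm2 (commU1 f_sqr f_corr (gi p q)).
    (* Two moves change at most four half-edges and 1 - theta^4 is at most 4 (2/b), which yields the
       constant 2 * 4 * 2 = 16. *)
    apply: le_trans (_ : \sum_(x : X) 2 * m'.+1%:R * (4 * (2 / b%:R)) <= _).
      apply: ler_sum => x _; rewrite ler_wpM2l ?mulr_ge0 //.
      set h := ham _ _; have h4 : (h <= 4)%N.
        apply: leq_trans (ham_triangle _ (c (mv (inord q) x)) _) _.
        by apply: (@leq_add _ _ 2 2); exact: mv_ham.
      apply: le_trans (bernoulli_le h _) _.
        rewrite subr_ge0 ler_pdivrMr // mul1r ler_nat ltnW //=.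
        by rewrite lerBlDr lerDl divr_ge0.
      by rewrite opprB addrC subrK ler_wpM2r ?divr_ge0 // ler_nat.
    rewrite sumr_const eb /d card_prod card_ord natrM -[leLHS]mulr_natr.
    rewrite le_eqVlt; apply/orP; left; apply/eqP.
    by field; rewrite gt_eqF.
  move=> i j; rewrite /N; case: ifP => _; first exact: cV.
  case: ifP => _; first exact: cV.
  by rewrite /comm2 mulmx1 mul1mx subrr frob20.
move=> e rho [urho rhoM] he ht.
have nearE t : frob2 (rho (test_elt i0 i1 j0 j1 t) -
    dilate e (prep M N (test_elt i0 i1 j0 j1 t))) <= 12 * kappa * d%:R.
  apply: frob2_ext_le => //.
  - by rewrite kappa0 /=; lra.
  - exact: unitary_prep.
pose gs (s : 'I_3) : FreeGroup m := match val s with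
  | 0 => fgen j0 | 1 => fgen j1 | _ => fg_mul (fgenV j0) (fgen j1) end%N.
have f1 h : prep M N (fg_one k, h) = fgmx N h by rewrite /prep /= mul1mx.
have e2 : test_elt i0 i1 j0 j1 (inord 2) = (fg_one k, fgen j0).
  by rewrite /test_elt /= inordK.
have e3 : test_elt i0 i1 j0 j1 (inord 3) = (fg_one k, fgen j1).
  by rewrite /test_elt /= inordK.
have e4 : test_elt i0 i1 j0 j1 (inord 4) = (fg_one k, fg_mul (fgenV j0) (fgen j1)).
  by rewrite /test_elt /= inordK.
have eM0 : M i0 = U1 f by rewrite /M eqxx.
have eM1 : M i1 = U2 R X m' by rewrite /M eq_sym (negbTE i01) eqxx.
have eN0 : N j0 = Vp R m' (g 0 1)%N by rewrite /N eqxx.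
have eN1 : N j1 = Vp R m' (g 0 2)%N by rewrite /N eq_sym (negbTE j01) eqxx.
have eV : adjmx (Vp R m' (g 0 1)%N) = Vp R m' (g 1 0)%N.
  rewrite -[LHS]mulmx1 -[1%:M](_ : Vp R m' (g 0 1)%N *m Vp R m' (g 1 0)%N = _).
    by rewrite mulmxA unitaryV ?mul1mx //; exact: unitary_Vp.
  rewrite VpM; apply: kmx_eq => z z'; rewrite kmxE one_ix /g /=.
  by rewrite !mv_inv -surjective_pairing.
(* The group averaged over is F_m, acting through rho(1, h); its exact commutation with the images
   of the F_k generators supplies [comm1P] and [comm2P]. *)
apply: (@paradox R X E c m' f (1 - 2 / b%:R) m_odd f_sqr f_corr b
  (fun h => @theta_half R b h b2) mv W mv_inv W_uniq W_par d0 e kappa kappa0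
  kappa1 he (FreeGroup m) (fun h => rho (fg_one k, h)) (fg_one m)
  (rho (fgen i0, fg_one m)) (rho (fgen i1, fg_one m)) _ _ _ _ _
  (fun s => rho (fg_one k, gs s)) (fun s h => fg_mul (gs s) h)).
- by move=> h; exact: urho.
- by move=> h; rewrite -!rhoM /prod_mul /= !fg_mul_comm1.
- by move=> h; rewrite -!rhoM /prod_mul /= !fg_mul_comm1.
- have := nearE (inord 0); rewrite /test_elt /= inordK //= /prep /= /fgmx /= !mulmx1.
  by rewrite /lmx /= eM0.
- have := nearE (inord 1); rewrite /test_elt /= inordK //= /prep /= /fgmx /= !mulmx1.
  by rewrite /lmx /= eM1.
- by move=> s; exact: urho.
- by move=> s h; rewrite -rhoM /prod_mul /= fg_mul11.
move=> s; have gsE : Vp R m' (gmap mv s) = fgmx N (gs s).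
  case: s => -[|[|[|//]]] ? ; rewrite /gmap /colour_pair /gs /=.
  - by rewrite /fgmx /= mulmx1 /lmx /= eN0.
  - by rewrite /fgmx /= mulmx1 /lmx /= eN1.
  - rewrite fgmxM // /fgmx /= !mulmx1 /lmx /= eN0 eN1 eV VpM.
    by apply: Vp_ext => x; rewrite /g /= mv_inv.
rewrite gsE.
case: s {gsE} => -[|[|[|//]]] ? ; rewrite /gs /=.
- by have := nearE (inord 2); rewrite e2 f1.
- by have := nearE (inord 3); rewrite e3 f1.
- by have := nearE (inord 4); rewrite e4 f1.
Qed.

Lemma nat_eventually_small (R : realType) (a eps : R) : 0 <= a -> 0 < eps ->
  exists N : nat, forall n, (N <= n)%N -> a / (2 * n + 3)%:R <= eps.
Proof.
move=> a0 e0; have [N hN] : exists N : nat, a / eps < N%:R.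
  by exists (Num.bound (a / eps)); apply: archi_boundP; rewrite divr_ge0 // ltW.
exists N => n Nn; rewrite ler_pdivrMr ?ltr0n; last by lia.
rewrite -ler_pdivrMl // mulrC; apply: le_trans (ltW hN) _.
by rewrite ler_nat; lia.
Qed.


Theorem theoremB (R : realType) (k m : nat) :
  (2 <= k)%N -> (2 <= m)%N ->
  ~ flexibly_HS_stable R (@prod_mul k m).
Proof.
move=> k2 m2 stable.
pose i0 : 'I_k := Ordinal (ltnW k2); pose i1 : 'I_k := Ordinal k2.
pose j0 : 'I_m := Ordinal (ltnW m2); pose j1 : 'I_m := Ordinal m2.
pose kappa : R := (1000 * 1000 * 1000)^-1.
have kappa0 : 0 < kappa by rewrite invr_gt0 !mulr_gt0.
have kappa1 : kappa * (1000 * 1000 * 1000) <= 1.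
  by rewrite mulVf // gt_eqF // !mulr_gt0.
have /choice[F spec] n := exists_obstructing n (isT : i0 != i1) (isT : j0 != j1)
  kappa0 kappa1.
pose d n := projT1 (F n); pose M n := (projT2 (F n)).1; pose N n := (projT2 (F n)).2.
have d0 n : (0 < d n)%N by have [h _ _ _ _] := spec n; exact: h.
have uM n i : unitary (M n i) by have [_ h _ _ _] := spec n; exact: h.
have uN n j : unitary (N n j) by have [_ _ h _ _] := spec n; exact: h.
have cMN n i j : comm2 (M n i) (N n j) <= 16 / (2 * n + 3)%:R * (d n)%:R.
  by have [_ _ _ h _] := spec n; exact: h.
pose phi n : FkFm k m -> 'M[R[i]]_(d n) := prep (M n) (N n).
have ah : asymptotic_hom (@prod_mul k m) phi.
  split=> [n g|g h]; first exact: unitary_prep (uM n) (uN n) g.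
  apply: (frob2_hs_cvg0 d0) => eps e0.
  (* This constant depends on the two group elements but not on n. *)
  pose C : R := 4 ^+ size (sval h.1) * (4 ^+ size (sval g.2)).
  have C0 : 0 <= C by rewrite mulr_ge0 // exprn_ge0.
  have [n0 hn0] := nat_eventually_small (mulr_ge0 C0 (ler0n R 16)) e0.
  exists n0 => n /hn0 hn.
  apply: le_trans (prep_defect (uM n) (uN n) g h _ (cMN n)) _.
    by rewrite mulr_ge0 ?divr_ge0.
  rewrite mulrA -/C !mulrA ler_wpM2r // -mulrA; exact: hn.
have [e [rho [urep [dims close]]]] := stable d phi d0 ah.
have [n1 hn1] := dims kappa kappa0.
have k20 : 0 < kappa ^+ 2 by rewrite exprn_gt0.
have /choice[nt hnt] t := hs_cvg0_frob2 d0 (close (test_elt i0 i1 j0 j1 t)) k20.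
(* One index at which the dimension ratio and all five test elements are within tolerance. *)
pose n := maxn n1 (\max_t nt t).
case: (spec n) => _ _ _ _ /(_ (e n) (rho n) (urep n)); apply.
  have := hn1 n (leq_maxl _ _); rewrite natrD mulrDl divff ?pnatr_eq0 -?lt0n //.
  rewrite addrAC subrr add0r ger0_norm ?divr_ge0 // ltr_pdivrMr ?ltr0n //.
  exact: ltW.
move=> t; apply: hnt; apply: leq_trans (leq_maxr _ _); exact: leq_bigmax.
Qed.
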